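(* The Drinfeld–Gavarini dual $Y^{\mathrm{rtt}}_\hbar(\mathfrak{gl}_n)'$ is free over $\mathbb{C}[\hbar]$, with a basis given by the ordered PBW monomials in the elements $\{\hbar t^{(r)}_{ij}\}_{1\leq i,j\leq n}^{r\geq 1}$. In particular, $Y^{\mathrm{rtt}}_\hbar(\mathfrak{gl}_n)'=\mathbf{Y}^{\mathrm{rtt}}_\hbar(\mathfrak{gl}_n)$.
   Context: Let $\hbar$ be a formal variable, $E_{ij}$ matrix units, $P=\sum_{i,j}E_{ij}\otimes E_{ji}$, $R(z)=1-\frac{\hbar}{z}P$. The RTT Yangian $Y^{\mathrm{rtt}}_\hbar(\mathfrak{gl}_n)$ is the associative $\mathbb{C}[\hbar]$-algebra generated by $\{t^{(r)}_{ij}\}_{1\leq i,j\leq n}^{r\geq1}$ subject to $R(z-w)T_1(z)T_2(w)=T_2(w)T_1(z)R(z-w)$ (after multiplying by $z-w$), where $T(z)=\sum_{i,j}t_{ij}(z)\otimes E_{ij}$, $t_{ij}(z)=\delta_{ij}+\hbar\sum_{r\geq1}t^{(r)}_{ij}z^{-r}$. It is a Hopf algebra over $\mathbb{C}[\hbar]$ with coproduct $\Delta(t_{ij}(z))=\sum_kt_{ik}(z)\otimes t_{kj}(z)$ and counit $\epsilon(t_{ij}(z))=\delta_{ij}$. $\mathbf{Y}^{\mathrm{rtt}}_\hbar(\mathfrak{gl}_n)$ is the $\mathbb{C}[\hbar]$-subalgebra generated by $\{\hbar t^{(r)}_{ij}\}$. For a Hopf algebra $A$ over $\mathbb{C}[\hbar]$,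 set $\Delta^0=\epsilon$, $\Delta^1=\mathrm{id}$, $\Delta^n=(\Delta\otimes\mathrm{id}^{\otimes(n-2)})\circ\Delta^{n-1}$, $\delta_n=(\mathrm{id}-\epsilon)^{\otimes n}\circ\Delta^n$; the Drinfeld–Gavarini dual is $A'=\{a\in A:\delta_n(a)\in\hbar^nA^{\otimes n}\ \forall n\in\mathbb{N}\}$. Ordered PBW monomials are taken with respect to a fixed total order on the index set $\{(i,j,r)\}$.
   Formalization: The RTT relations are imposed after division by ħ² (with the coproduct on generators divided by ħ), since imposing them undivided creates ħ-torsion, e.g. ħ[t^(1),t^(2)] for n=1, and the dual is then not free. *)

(* Defs.v *)
(* Concrete model of the RTT Yangian Y^rtt_hbar(gl_n), its
   tensor powers, the iterated coproducts and the Drinfeld--Gavarini dual,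
   via the free algebra on the generators and explicit ideal membership. *)
From HB Require Import structures.
From mathcomp Require Import all_boot all_order all_algebra.
Set Implicit Arguments. Unset Strict Implicit. Unset Printing Implicit Defensive.
Import Order.TTheory GRing.Theory Num.Theory.
Local Open Scope ring_scope.

Section Yangian.
Variable F : fieldType.
Variable n : nat.
Local Notation K := {poly F}.
Local Notation hb := ('X : K).

(* generator index (i, j, r)  <->  t^{(r+1)}_{ij}  (paper index r+1 >= 1) *)
Definition gen : Type := ('I_n * 'I_n * nat)%type.
(* a word in the generators = a basis element of the free C[hbar]-algebra *)
Definition word : Type := seq gen.

(* formal finite K-linear combinations of basis elements of type B;
   two of them denote the same vector iff their [coefv] agree *)
Definition vec (B : Type) := seq (K * B).
Definition coefv (B : eqType) (v : vec B) (b : B) : K :=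
  \sum_(p <- v | p.2 == b) p.1.
Definition vscale (B : Type) (c : K) (v : vec B) : vec B :=
  [seq (c * p.1, p.2) | p <- v].
Definition vsub (B : Type) (v w : vec B) : vec B := v ++ vscale (-1) w.
Definition lincomb (B B' : Type) (S : B' -> vec B) (l : vec B') : vec B :=
  flatten [seq vscale p.1 (S p.2) | p <- l].

Definition vmul (x y : vec word) : vec word :=
  [seq (p.1 * q.1, p.2 ++ q.2) | p <- x, q <- y].
Definition comm (x y : vec word) : vec word := vsub (vmul x y) (vmul y x).

(* T^{(r)}_{ij} = coefficient of z^{-r} in t_ij(z):
   delta_ij for r = 0, hbar t^{(r)}_{ij} for r >= 1 *)
Definition Tgen (i j : 'I_n) (r : nat) : vec word :=
  if r is r'.+1 then [:: (hb, [:: (i, j, r')])] else [:: ((i == j)%:R, [::])].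

(* coefficient of z^{-r} w^{-s} (r, s >= 0) of the RTT relation
   (z-w)[t_ij(z), t_kl(w)] = hbar (t_kj(z) t_il(w) - t_kj(w) t_il(z)) *)
Definition relT (i j k l : 'I_n) (r s : nat) : vec word :=
  vsub (vsub (comm (Tgen i j r.+1) (Tgen k l s)) (comm (Tgen i j r) (Tgen k l s.+1)))
       (vscale hb (vsub (vmul (Tgen k j r) (Tgen i l s))
                        (vmul (Tgen k j s) (Tgen i l r)))).

(* the same relation divided by hbar^2 (it is divisible; division by a fixed
   polynomial is linear, so dividing coefficientwise is legitimate) *)
Definition relidx : Type := ('I_n * 'I_n * 'I_n * 'I_n * nat * nat)%type.
Definition rel (ix : relidx) : vec word :=
  let: (i, j, k, l, r, s) := ix in
  [seq (divp p.1 ('X ^+ 2), p.2) | p <- relT i j k l r s].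

(* coproduct on a generator:
   Delta t^{(r)}_{ij} = t^{(r)}_{ij} (x) 1 + 1 (x) t^{(r)}_{ij}
       + hbar sum_k sum_{a+b=r, a,b>=1} t^{(a)}_{ik} (x) t^{(b)}_{kj} *)
Definition dletter (g : gen) : vec (word * word) :=
  let: (i, j, r) := g in
  [:: (1, ([:: g], [::])); (1, ([::], [:: g]))] ++
  [seq (hb, ([:: (i, k, a)], [:: (k, j, (r.-1 - a)%N)])) | k <- enum 'I_n, a <- iota 0 r].

Fixpoint dword (w : word) : vec (word * word) :=
  match w with
  | [::] => [:: (1, ([::], [::]))]
  | g :: w' => [seq (p.1 * q.1, (p.2.1 ++ q.2.1, p.2.2 ++ q.2.2))
                | p <- dletter g, q <- dword w']
  end.

(* elements of the m-th tensor power of the free algebra: combinations of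
   m-tuples (as sequences) of words.  (Delta (x) id^{(x)(m-1)}): *)
Definition dtens (v : vec (seq word)) : vec (seq word) :=
  flatten [seq (if p.2 is w :: ws then
                 [seq (p.1 * q.1, q.2.1 :: q.2.2 :: ws) | q <- dword w]
               else [::]) | p <- v].

Definition eps (w : word) : K := if w is [::] then 1 else 0.

Definition Deltan (m : nat) (x : vec word) : vec (seq word) :=
  match m with
  | 0 => [seq (eps p.2 * p.1, [::]) | p <- x]
  | m'.+1 => iter m' dtens [seq (p.1, [:: p.2]) | p <- x]
  end.

(* (id - eps)^{(x) m} : kills tensor words having an empty factor *)
Definition proj (v : vec (seq word)) : vec (seq word) :=
  [seq p <- v | all (fun w => w != [::]) p.2].

Definition deltan (m : nat) (x : vec word) : vec (seq word) := proj (Deltan m x).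

(* generators of the kernel J_m of F^{(x)m} -> Y^{(x)m}:
   w_1 (x) ... (x) (u * rel * v) (x) ... (x) w_m *)
Definition jgenidx : Type := (seq word * word * relidx * word * seq word)%type.
Definition jgen (q : jgenidx) : vec (seq word) :=
  let: (pre, u, ix, v, post) := q in
  [seq (p.1, pre ++ (u ++ p.2 ++ v) :: post) | p <- rel ix].

(* v lies in J_m, i.e. v = 0 in Y^{(x) m} *)
Definition inJ (m : nat) (v : vec (seq word)) : Prop :=
  exists l : vec jgenidx,
    all (fun p : K * jgenidx => let: (pre, _, _, _, post) := p.2 in
                                (size pre + size post).+1 == m) l /\
    forall b, coefv v b = coefv (lincomb jgen l) b.

(* x = 0 in the Yangian Y = F / I *)
Definition inI (x : vec word) : Prop := inJ 1 [seq (p.1, [:: p.2]) | p <- x].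

Definition DGdual (x : vec word) : Prop :=
  forall m : nat, exists y : vec (seq word),
    inJ m (vsub (deltan m x) (vscale ('X ^+ m) y)).

(* the monomial (hbar t_{g1}) ... (hbar t_{gk}) = hbar^k t_{g1} ... t_{gk} *)
Definition pbw (w : word) : vec word := [:: ('X ^+ size w, w)].

End Yangian.

(* Main.v *)
Require Import Defs.
From HB Require Import structures.
From mathcomp Require Import finmap.
From mathcomp.multinomials Require Import monalg.
From mathcomp Require Import all_boot all_order all_algebra.
From mathcomp Require Import zify.
Set Implicit Arguments. Unset Strict Implicit. Unset Printing Implicit Defensive.
Import Order.TTheory GRing.Theory Num.Theory.
Local Open Scope ring_scope.

(** The coefficient of [a^r] in the [(i, j)] entry of the vector representation
    [t^(r+1)_ij |-> a^r E_ij] is a functional on the Yangian which is dual to the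
    generators.  Applying such functionals, one for each letter of a word [g] of
    length [m], to [delta_m] of a combination [sum_w c_w t^w] of ordered monomials
    gives [sum_w c_w H(g, w)], where [hbar^m] divides [hbar^|w| H(g, w)], and where
    for [|w| = m] the value of [H(g, w)] at [hbar = 0] is a positive integer if [w] is
    a rearrangement of [g] and [0] otherwise.  Looking at the shortest [w] for which
    [|w| - val(c_w)] is maximal, one sees that if [hbar^(m+N)] divides all these
    numbers then [hbar^(|w|+N)] divides every [c_w].  With [N = 0] this describes
    the elements of the dual; with all [N] it gives linear independence.  The PBW
    theorem for the tensor powers of the Yangian is not needed. *)

(** * Linear extensions and formal combinations *)

Section LinearExtension.
Variables (R : comNzRingType) (B : choiceType) (V : lmodType R).
Implicit Types (f : B -> V) (a : {malg R[B]}).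

Definition mext f a : V := \sum_(k <- msupp a) a@_k *: f k.

Lemma mextEw f a (d : {fset B}) :
  fsubset (msupp a) d -> mext f a = \sum_(k <- d) a@_k *: f k.
Proof.
move=> le; rewrite /mext (big_fset_incl _ le) // => k _ /mcoeff_outdom ->.
by rewrite scale0r.
Qed.

Lemma mext_is_linear f : linear (mext f).
Proof.
move=> c a b.
pose d := fsetU (msupp a) (msupp b).
have ha : fsubset (msupp a) d by exact: fsubsetUl.
have hb : fsubset (msupp b) d by exact: fsubsetUr.
rewrite (mextEw f ha) (mextEw f hb) (mextEw f (d := d)); last first.
  apply: fsubset_trans (msuppD_le _ _) _.
  by rewrite fsubUset hb andbT (fsubset_trans (msuppZ_le _ _)).
rewrite scaler_sumr -big_split; apply: eq_bigr => k _.
by rewrite mcoeffD mcoeffZ scalerDl scalerA.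
Qed.

HB.instance Definition _ f :=
  GRing.isLinear.Build R {malg R[B]} V *:%R (mext f) (mext_is_linear f).

Lemma mextU f c b : mext f << c *g b >> = c *: f b.
Proof. by rewrite (mextEw f msuppU_le) big_seq_fset1 mcoeffUU. Qed.

Lemma mext_eq f g : f =1 g -> mext f =1 mext g.
Proof. by move=> fg a; apply: eq_bigr => k _; rewrite fg. Qed.

End LinearExtension.

Section LinearModulo.
Variables (R : comNzRingType) (U V Z : lmodType R) (L : {linear U -> V}).

Lemma linear_subZ_eq (L' : {linear V -> Z}) (c : R) x y :
  L' (x - c *: y) = 0 -> L' x = c *: L' y.
Proof. by rewrite linearB linearZ => /eqP; rewrite subr_eq0 => /eqP. Qed.

Lemma linear_comp_sub_eq (L' : {linear V -> Z}) x y :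
  L' (L (x - y)) = 0 -> L' (L x) = L' (L y).
Proof. by rewrite !linearB => /eqP; rewrite subr_eq0 => /eqP. Qed.

Lemma mext_scaler (B : choiceType) (f : B -> R) (v : V) a :
  mext (fun b => f b *: v) a = mext (f : B -> R^o) a *: v.
Proof. by rewrite /mext scaler_suml; apply: eq_bigr => b _; rewrite scalerA. Qed.

Variables (J : V -> Prop) (c : R).
Hypotheses (J0 : J 0) (JD : forall x y, J x -> J y -> J (x + y))
           (JZ : forall d x, J x -> J (d *: x)).
(** For [L = delta_m], [J] the relation ideal and [c = hbar^m] this is the [m]-th condition defining
    the dual. In this abstract form its closure properties are proved for all [m] at once. *)
Definition modulo x := exists y, J (L x - c *: y).

Lemma modulo_zero : modulo 0.
Proof. by exists 0; rewrite linear0 scaler0 subr0. Qed.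

Lemma modulo_add x y : modulo x -> modulo y -> modulo (x + y).
Proof.
move=> [x' hx] [y' hy]; exists (x' + y').
by rewrite linearD scalerDr opprD addrACA; apply: JD.
Qed.

Lemma modulo_scale d x : modulo x -> modulo (d *: x).
Proof.
move=> [x' hx]; exists (d *: x').
by rewrite linearZ /= scalerA mulrC -scalerA -scalerBr; apply: JZ.
Qed.

Lemma modulo_sub x y : J (L (x - y)) -> modulo y -> modulo x.
Proof.
move=> hxy [y' hy]; exists y'.
by have := JD hxy hy; rewrite linearB addrA subrK.
Qed.

End LinearModulo.

Lemma scale_malgU (R : comNzRingType) (B : choiceType) (c : R) (b : B) :
  c *: << b >> = << c *g b >> :> {malg R[B]}.
Proof. by apply/malgP => k; rewrite mcoeffZ !mcoeffU mulrnAr mulr1. Qed.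

Section Vec.
Variables (F : fieldType).
Local Notation K := {poly F}.

Section Ext.
Variable V : lmodType K.

Definition ext (B : Type) (f : B -> V) (v : vec F B) : V :=
  \sum_(p <- v) p.1 *: f p.2.

Lemma ext_cat B (f : B -> V) v w : ext f (v ++ w) = ext f v + ext f w.
Proof. by rewrite /ext big_cat. Qed.

Lemma ext_pair1 B (f : B -> V) a b : ext f [:: (1, a); (1, b)] = f a + f b.
Proof. by rewrite /ext !big_cons big_nil addr0 !scale1r. Qed.

Lemma ext_allpairs B S U (f : B -> V) (c : K) (g : S -> U -> B) s t :
  ext f [seq (c, g x y) | x <- s, y <- t] =
  c *: \sum_(x <- s) \sum_(y <- t) f (g x y).
Proof.
rewrite /ext big_allpairs_dep scaler_sumr; apply: eq_bigr => x _.
by rewrite scaler_sumr.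
Qed.

Lemma ext_scale B (f : B -> V) c v : ext f (vscale c v) = c *: ext f v.
Proof.
by rewrite /ext big_map scaler_sumr; apply: eq_bigr => p _; rewrite scalerA.
Qed.

Lemma ext_sub B (f : B -> V) v w : ext f (vsub v w) = ext f v - ext f w.
Proof. by rewrite ext_cat ext_scale scaleN1r. Qed.

Lemma ext_lincomb B B' (f : B -> V) (S : B' -> vec F B) l :
  ext f (lincomb S l) = ext (fun q => ext f (S q)) l.
Proof.
by rewrite /ext big_flatten big_map; apply: eq_bigr => p _; rewrite -ext_scale.
Qed.

Lemma eq_ext B (f g : B -> V) v : f =1 g -> ext f v = ext g v.
Proof. by move=> fg; apply: eq_bigr => p _; rewrite fg. Qed.

End Ext.

(** Passage from formal combinations to the free module, where coefficientwise equality becomes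
    equality. *)
Definition mal (B : choiceType) : vec F B -> {malg K[B]} := ext (fun b => << b >>).

Lemma mext_mal (B : choiceType) (V : lmodType K) (f : B -> V) v :
  mext f (mal v) = ext f v.
Proof.
rewrite /mal /ext linear_sum; apply: eq_bigr => p _.
by rewrite linearZ /= mextU scale1r.
Qed.

Lemma linear_ext (U V : lmodType K) (L : {linear U -> V}) B (f : B -> U) v :
  L (ext f v) = ext (L \o f) v.
Proof. by rewrite /ext linear_sum; apply: eq_bigr => p _; rewrite linearZ. Qed.

Lemma coefv_mal (B : choiceType) (v : vec F B) b : coefv v b = (mal v)@_b.
Proof.
rewrite /coefv /mal /ext raddf_sum /= big_mkcond; apply: eq_bigr => p _ /=.
by rewrite mcoeffZ mcoeffU; case: eqP; rewrite ?mulr1 ?mulr0.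
Qed.

Lemma eq_mal (B : choiceType) (v w : vec F B) :
  (forall b, coefv v b = coefv w b) <-> mal v = mal w.
Proof.
split=> [h | h b]; last by rewrite !coefv_mal h.
by apply/malgP => b; rewrite -!coefv_mal.
Qed.

Lemma mal_surj (B : choiceType) (a : {malg K[B]}) : exists v, mal v = a.
Proof.
exists [seq (a@_k, k) | k <- msupp a].
rewrite /mal /ext big_map [RHS]monalgE; apply: eq_bigr => k _ /=.
by rewrite scale_malgU.
Qed.

End Vec.

(** * The divided relations in explicit form *)

Section Rel.
Variables (F : fieldType) (n : nat).
Local Notation K := {poly F}.
Variables (V : lmodType K) (phi : word n -> V).
Implicit Types i j k l : 'I_n.

Lemma divpX2 (c : K) : (c * 'X^2) %/ 'X^2 = c.
Proof. by rewrite mulpK // -size_poly_eq0 size_polyXn. Qed.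

(** Terms of degree one in [hbar] come from commutators with a scalar [T^(0)] or, when [r = s = 0],
    from products of two scalars. They cancel in pairs, so losing them in the division is
    harmless. *)
Lemma divpX2_lin (b : nat) : ('X * b%:R : K) %/ 'X^2 = 0.
Proof.
rewrite divp_small // size_polyXn mulr_natr -scaler_nat.
by rewrite (leq_ltn_trans (size_scale_leq _ _)) // size_polyX.
Qed.

Ltac expand_rel :=
  rewrite /ext /Defs.rel big_map /= /relT /comm /vsub /vmul /vscale /= !big_cons big_nil /=
    !mulN1r ?mulrN !opprK !divpN.

Lemma ext_rel00 i j k l : ext phi (Defs.rel F (i, j, k, l, 0%N, 0%N)) = 0.
Proof.
expand_rel; rewrite ![_%:R * 'X]mulrC -!natrM !divpX2_lin.
by rewrite !(oppr0, scale0r, addr0).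
Qed.

Lemma ext_rel0S i j k l s :
  ext phi (Defs.rel F (i, j, k, l, 0%N, s.+1)) =
  phi [:: (i, j, 0%N); (k, l, s)] - phi [:: (k, l, s); (i, j, 0%N)]
  - ((k == j)%:R *: phi [:: (i, l, s)] - (i == l)%:R *: phi [:: (k, j, s)]).
Proof.
expand_rel; rewrite ![_%:R * 'X]mulrC !divpX2_lin !mulrA ![_ * _%:R]mulrC.
rewrite -expr2 !divpX2 -[X in X %/ _]mul1r divpX2.
by rewrite !(oppr0, scale0r, add0r, addr0, scaleNr, scale1r) opprB !addrA addrAC.
Qed.

Lemma ext_relS0 i j k l r :
  ext phi (Defs.rel F (i, j, k, l, r.+1, 0%N)) =
  - (phi [:: (i, j, r); (k, l, 0%N)] - phi [:: (k, l, 0%N); (i, j, r)])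
  - ((i == l)%:R *: phi [:: (k, j, r)] - (k == j)%:R *: phi [:: (i, l, r)]).
Proof.
expand_rel; rewrite ![_%:R * 'X]mulrC !divpX2_lin !mulrA ![_ * _%:R]mulrC.
rewrite -expr2 !divpX2 -[X in X %/ _]mul1r divpX2.
rewrite !(oppr0, scale0r, add0r, addr0, scaleNr, scale1r) !opprB !addrA.
by rewrite addrAC [_ + phi _]addrC.
Qed.

Lemma ext_relSS i j k l r s :
  ext phi (Defs.rel F (i, j, k, l, r.+1, s.+1)) =
  phi [:: (i, j, r.+1); (k, l, s)] - phi [:: (k, l, s); (i, j, r.+1)]
  - (phi [:: (i, j, r); (k, l, s.+1)] - phi [:: (k, l, s.+1); (i, j, r)])
  - 'X *: (phi [:: (k, j, r); (i, l, s)] - phi [:: (k, j, s); (i, l, r)]).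
Proof.
expand_rel; rewrite -expr2 !divpX2 -[X in X %/ _]mul1r divpX2.
rewrite !(oppr0, scale0r, add0r, addr0, scaleNr, scale1r) scalerBr !opprB !addrA.
by rewrite addrAC [_ - phi [:: (i, j, r); _] + _]addrAC.
Qed.
End Rel.

(** * The relation ideals and the operators on tensor powers *)

Section TensorIdeal.
Variables (F : fieldType) (n : nat).
Local Notation K := {poly F}.
Local Notation W := (word n).
Local Notation T := {malg K[seq W]}.
Implicit Types (a b : T) (q : jgenidx n) (ix : relidx n) (u v : W).

Definition ext_rel (V : lmodType K) (f : W -> V) ix := ext f (Defs.rel F ix).

Definition jsize q :=
  let: (pre, _, _, _, post) := q in (size pre + size post).+1.
Definition jelt q : T := mal (jgen F q).

Lemma ext_jgen (V : lmodType K) (f : seq W -> V) pre u ix v post :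
  ext f (jgen F (pre, u, ix, v, post)) =
  ext_rel (fun p => f (pre ++ (u ++ p ++ v) :: post)) ix.
Proof. by rewrite /ext_rel /ext big_map. Qed.

Definition inJm m a := exists l : vec F (jgenidx n),
  all (fun p => jsize p.2 == m) l /\ a = ext jelt l.

Lemma inJP m (x : vec F (seq W)) : inJ m x <-> inJm m (mal x).
Proof.
have E l : all (fun p : K * jgenidx n => let: (pre, _, _, _, post) := p.2 in
    (size pre + size post).+1 == m) l = all (fun p => jsize p.2 == m) l.
  by apply: eq_all => -[c [[[[pre u] ix] v] post]].
split=> -[l [hl hv]]; exists l; split; rewrite ?E // -?E //.
- by move/eq_mal: hv => ->; rewrite /mal ext_lincomb.
- by apply/eq_mal; rewrite hv /mal ext_lincomb.
Qed.

Lemma inJm_zero m : inJm m 0.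
Proof. by exists [::]; rewrite /ext big_nil. Qed.

Lemma inJm_add m a b : inJm m a -> inJm m b -> inJm m (a + b).
Proof.
move=> [l [hl ->]] [l' [hl' ->]]; exists (l ++ l').
by rewrite all_cat hl hl' ext_cat.
Qed.

Lemma inJm_scale m c a : inJm m a -> inJm m (c *: a).
Proof.
move=> [l [hl ->]]; exists (vscale c l); rewrite ext_scale all_map; split=> //.
Qed.

Lemma inJm_sum m I (r : seq I) (P : pred I) (f : I -> T) :
  (forall i, P i -> inJm m (f i)) -> inJm m (\sum_(i <- r | P i) f i).
Proof. exact/(big_ind (inJm m))/inJm_add/inJm_zero. Qed.

Lemma inJm_ext m B (f : B -> T) (x : vec F B) :
  (forall y, inJm m (f y)) -> inJm m (ext f x).
Proof. by move=> hf; apply: inJm_sum => p _; apply: inJm_scale. Qed.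

Lemma inJm_jelt q : inJm (jsize q) (jelt q).
Proof.
exists [:: (1, q)]; split; first by rewrite /= eqxx.
by rewrite /ext big_seq1 scale1r.
Qed.

Lemma inJm_gen m pre u ix v post : (size pre + size post).+1 = m ->
  inJm m (ext_rel (fun p => << pre ++ (u ++ p ++ v) :: post >>) ix).
Proof.
move=> <-; have := inJm_jelt (pre, u, ix, v, post).
by rewrite /jelt /mal ext_jgen.
Qed.

(** The linear map [L] is built in so that both the stability of the ideals under an operator and
    the vanishing of a functional on them are instances. *)
Lemma inJm_ind m (V : lmodType K) (P : V -> Prop) (L : {linear T -> V}) a :
  P 0 -> (forall x y, P x -> P y -> P (x + y)) -> (forall c x, P x -> P (c *: x)) ->
  (forall q, jsize q = m -> P (L (jelt q))) -> inJm m a -> P (L a).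
Proof.
move=> P0 PD PZ Pq [l [hl ->]]; rewrite linear_ext.
elim: l hl => [|p l IH] /=; first by rewrite /ext big_nil.
rewrite /ext big_cons => /andP[/eqP hp hl]; apply: PD; last exact: IH.
exact/PZ/Pq.
Qed.

End TensorIdeal.

(** * Iterated coproducts and [delta_m] as linear maps *)

Section Operators.
Variables (F : fieldType) (n : nat).
Local Notation K := {poly F}.
Local Notation W := (word n).
Local Notation T := {malg K[seq W]}.

Definition Delta_head (ws : seq W) : T :=
  if ws is w :: ws' then ext (fun q => << q.1 :: q.2 :: ws' >>) (dword F w) else 0.
Definition proj_word (ws : seq W) : T :=
  if all (fun w => w != [::]) ws then << ws >> else 0.
Definition tens1 (w : W) : T := << [:: w] >>.

Lemma mal_dtens v : mal (dtens v) = mext Delta_head (mal v).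
Proof.
rewrite mext_mal /mal /ext /dtens big_flatten big_map; apply: eq_bigr => -[c ws] _ /=.
case: ws => [|w ws]; first by rewrite big_nil scaler0.
rewrite big_map scaler_sumr; apply: eq_bigr => q _ /=.
by rewrite scalerA.
Qed.

Lemma mal_proj v : mal (proj v) = mext proj_word (mal v).
Proof.
rewrite mext_mal /mal /ext big_filter big_mkcond; apply: eq_bigr => p _.
by rewrite /proj_word; case: ifP; rewrite ?scaler0.
Qed.

Definition Deltam m (a : {malg K[W]}) : T :=
  if m is m'.+1 then iter m' (mext Delta_head) (mext tens1 a)
  else mext (fun w => eps F w *: << [::] >>) a.

Lemma Deltam_is_linear m : linear (Deltam m).
Proof.
case: m => [|m]; first exact: linearP.
elim: m => [|m IH] c a b /=; first exact: linearP.
by rewrite /Deltam /= in IH *; rewrite IH linearP.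
Qed.
HB.instance Definition _ m :=
  GRing.isLinear.Build K {malg K[W]} T *:%R (Deltam m) (Deltam_is_linear m).

Lemma mal_tens1 (x : vec F W) : mal [seq (p.1, [:: p.2]) | p <- x] = mext tens1 (mal x).
Proof. by rewrite mext_mal /mal /ext big_map. Qed.

Lemma mal_Deltan m x : mal (Deltan m x) = Deltam m (mal x).
Proof.
case: m => [|m] /=.
  rewrite mext_mal /mal /ext big_map; apply: eq_bigr => p _ /=.
  by rewrite scalerA mulrC.
elim: m => [|m IH] /=; first exact: mal_tens1.
by rewrite mal_dtens IH.
Qed.

Definition deltam m a := mext proj_word (Deltam m a).

Lemma deltam_is_linear m : linear (deltam m).
Proof. by move=> c a b; rewrite /deltam !linearP. Qed.
HB.instance Definition _ m :=
  GRing.isLinear.Build K {malg K[W]} T *:%R (deltam m) (deltam_is_linear m).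

Lemma mal_deltan m x : mal (deltan m x) = deltam m (mal x).
Proof. by rewrite mal_proj mal_Deltan. Qed.

Definition inIm (a : {malg K[W]}) := inJm 1 (mext tens1 a).

Lemma inImP x : inI x <-> inIm (mal x).
Proof. by rewrite /inI inJP mal_tens1. Qed.

Lemma mal_scale (B : choiceType) c (v : vec F B) : mal (vscale c v) = c *: mal v.
Proof. exact: ext_scale. Qed.
Lemma mal_sub (B : choiceType) (v w : vec F B) : mal (vsub v w) = mal v - mal w.
Proof. exact: ext_sub. Qed.

Definition inDG (a : {malg K[W]}) := forall m, modulo (deltam m) (@inJm F n m) 'X^m a.

Lemma DGdualP x : DGdual x <-> inDG (mal x).
Proof.
split=> h m.
  have [y /inJP hy] := h m; exists (mal y).
  by rewrite mal_sub mal_scale mal_deltan in hy.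
have [b hb] := h m; have [y yb] := mal_surj b.
by exists y; apply/inJP; rewrite mal_sub mal_scale mal_deltan yb.
Qed.

End Operators.

(** * Functionals vanishing on the relations *)

Section Functionals.
Variables (F : fieldType) (n : nat).
Local Notation K := {poly F}.
Local Notation W := (word n).
Local Notation T := {malg K[seq W]}.
Implicit Types (i j k l : 'I_n) (u v w : W) (ix : relidx n).

Lemma linear_mext (B : choiceType) (U V : lmodType K) (L : {linear U -> V})
    (f : B -> U) a : L (mext f a) = mext (L \o f) a.
Proof. by rewrite /mext linear_sum; apply: eq_bigr => k _; rewrite linearZ. Qed.

(* t^{(r+1)}_{ij} acts by a^r E_ij, where a is the outer variable of {poly K}. *)
Definition rho w : 'M[{poly K}]_n :=
  foldr (fun (g : gen n) M => ('X^(g.2) *: delta_mx g.1.1 g.1.2) *m M) 1%:M w.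

Lemma rho_cat u v : rho (u ++ v) = rho u *m rho v.
Proof. by elim: u => [|g u IH] /=; rewrite ?mul1mx // IH mulmxA. Qed.

Lemma rho_letter i j r : rho [:: (i, j, r)] = 'X^r *: delta_mx i j.
Proof. by rewrite /= mulmx1. Qed.

Lemma rho_pair i j k l r s :
  rho [:: (i, j, r); (k, l, s)] = ('X^(r + s) *: delta_mx i l) *+ (k == j).
Proof.
rewrite /= mulmx1 -scalemxAl -scalemxAr scalerA -exprD mul_delta_mx_cond eq_sym.
by rewrite scalerMnr.
Qed.

Definition ev i j r w : K := (rho w i j)`_r.

(** Such an [f] vanishes on the two-sided ideal of the relations, hence is a functional on the
    Yangian. *)
Definition kills (f : W -> K) :=
  forall u ix v, ext_rel (fun p => f (u ++ p ++ v) : K^o) ix = 0.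

Lemma ext_scalar (f : W -> K) c x :
  ext (fun p => f p * c : K^o) x = ext (f : W -> K^o) x * c.
Proof. by rewrite /ext mulr_suml; apply: eq_bigr => p _; rewrite -scalerAl. Qed.

(** In the representation a product of two letters depends on their exponents only through [r + s],
    so the terms of the generic relation cancel in pairs. When one index is [0], what remains is the
    commutator of two matrix units. *)
Lemma kills_ev i j r : kills (ev i j r).
Proof.
move=> u ix v.
pose L (M : 'M[{poly K}]_n) : K := ((rho u *m M *m rho v) i j)`_r.
have LMn M (b : bool) : L (M *+ b) = (b%:R : K) *: (L M : K^o).
  case: b; rewrite ?mulr0n ?mulr1n ?scale1r // scale0r.
  by rewrite /L mulmx0 mul0mx mxE coef0.
have -> : ext_rel (fun p => ev i j r (u ++ p ++ v) : K^o) ix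
        = ext_rel (fun p => L (rho p) : K^o) ix.
  by apply: eq_ext => p; rewrite /ev /L !rho_cat mulmxA.
rewrite /ext_rel; case: ix => [[[[[i' j'] k] l] [|r']] [|s]].
- exact: ext_rel00.
- by rewrite ext_rel0S !rho_pair !rho_letter !LMn add0n addn0 subrr.
- by rewrite ext_relS0 !rho_pair !rho_letter !LMn add0n addn0 opprB subrr.
- rewrite ext_relSS !rho_pair !addSn !addnS [(s + r')%N]addnC.
  by rewrite !subrr scaler0 subr0.
Qed.

(** After the division every term that survives in a relation is a nonempty word, on which the
    counit is [0]. *)
Lemma kills_eps : kills (fun w => (w == [::])%:R).
Proof.
have bilin u v p : ((u ++ p ++ v) == [::]) = (u == [::]) && ((p == [::]) && (v == [::])).
  by case: u p v => [|? ?] [|? ?] [|? ?].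
move=> u ix v; rewrite /ext_rel.
case: ix => [[[[[i' j'] k] l] [|r']] [|s]];
  rewrite ?ext_rel00 ?ext_rel0S ?ext_relS0 ?ext_relSS //;
  by rewrite !bilin !andbF !(subrr, scaler0, oppr0).
Qed.

(* The value 0 at the empty word makes these functionals absorb id - eps. *)
Definition redf i j r w : K := if w == [::] then 0 else ev i j r w.

(** [redf] is [ev] minus a constant multiple of the counit, the constant being the value of [ev] at
    the empty word, and both of these kill the relations. *)
Lemma kills_redf i j r : kills (redf i j r).
Proof.
move=> u ix v.
have E w : redf i j r w = ev i j r w - (w == [::])%:R * ev i j r [::].
  by rewrite /redf; case: eqP => [->|]; rewrite ?mul1r ?mul0r ?subrr ?subr0.
pose e w : K := (w == [::])%:R.
rewrite /ext_rel /ext.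
transitivity (ext_rel (fun p => ev i j r (u ++ p ++ v) : K^o) ix -
  ext_rel (fun p => e (u ++ p ++ v) : K^o) ix * ev i j r [::]).
  rewrite /ext_rel /ext mulr_suml -sumrB; apply: eq_bigr => p _.
  by rewrite E -scalerAl -scalerBr.
by rewrite kills_ev kills_eps mul0r subr0.
Qed.

Lemma redf_nil i j r : redf i j r [::] = 0.
Proof. by []. Qed.

Lemma redf_letter (g h : gen n) : redf g.1.1 g.1.2 g.2 [:: h] = (g == h)%:R.
Proof.
case: g h => [[i j] r] [[k l] s].
rewrite /redf /ev rho_letter !mxE /= -pair_eqE /= -pair_eqE /=.
case: (i == k); case: (j == l); rewrite /= ?mulr1 ?mulr0 ?coef0 //.
by rewrite coefXn.
Qed.

(** The value is [0] on tuples whose length differs from that of [fs], so [Tens_inJm] can be stated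
    without comparing lengths. *)
Fixpoint tens (fs : seq (W -> K)) (ws : seq W) : K :=
  match fs, ws with
  | [::], [::] => 1
  | f :: fs', w :: ws' => f w * tens fs' ws'
  | _, _ => 0
  end.
Definition Tens fs (a : T) : K^o := mext (tens fs : seq W -> K^o) a.

Lemma Tens_is_linear fs : linear (Tens fs).
Proof. exact: linearP. Qed.
HB.instance Definition _ fs :=
  GRing.isLinear.Build K T K^o *:%R (Tens fs) (Tens_is_linear fs).

Fixpoint All (fs : seq (W -> K)) (P : (W -> K) -> Prop) : Prop :=
  if fs is f :: fs' then P f /\ All fs' P else True.

Lemma tens_rel fs pre u ix v post : All fs kills ->
  ext_rel (fun p => tens fs (pre ++ (u ++ p ++ v) :: post) : K^o) ix = 0.
Proof.
elim: pre fs => [|w pre IH] [|f fs] /=.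
- by move=> _; rewrite /ext_rel /ext big1 // => p _; rewrite scaler0.
- by move=> [kf _]; rewrite /ext_rel ext_scalar [X in X * _]kf mul0r.
- by move=> _; rewrite /ext_rel /ext big1 // => p _; rewrite scaler0.
move=> [_ kfs]; rewrite /ext_rel; under eq_ext do rewrite mulrC.
by rewrite (ext_scalar (fun p => tens fs (pre ++ (u ++ p ++ v) :: post))) [X in X * _]IH // mul0r.
Qed.

Lemma Tens_inJm m fs a : All fs kills -> inJm m a -> Tens fs a = 0.
Proof.
move=> kfs; apply: (inJm_ind (P := fun x => x = 0) (L := Tens fs)) => //.
- by move=> x y -> ->; rewrite addr0.
- by move=> c x ->; rewrite scaler0.
move=> [[[[pre u] ix] v] post] _.
by rewrite /= /Tens /jelt mext_mal ext_jgen; apply: tens_rel.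
Qed.

(** The convolution product of functionals, dual to the coproduct. *)
Definition conv (f1 f2 : W -> K) (w : W) : K :=
  \sum_(q <- dword F w) q.1 * (f1 q.2.1 * f2 q.2.2).

Lemma Tens_Delta_head f1 f2 fs a : Tens (f1 :: f2 :: fs) (mext (@Delta_head F n) a) = Tens (conv f1 f2 :: fs) a.
Proof.
rewrite /Tens linear_mext; apply: mext_eq => -[|w ws] /=.
  by rewrite linear0.
rewrite linear_ext /ext /conv mulr_suml; apply: eq_bigr => q _ /=.
by rewrite mextU scale1r /= -[LHS]/(q.1 * _) !mulrA.
Qed.

(** Each further coproduct splits the first tensor factor, and its transpose convolves the first two
    functionals. This is why the product is nested to the left. *)
Lemma Tens_Deltam f fs a :
  Tens (f :: fs) (Deltam (size fs).+1 a) = mext (foldl conv f fs : W -> K^o) a.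
Proof.
rewrite /Deltam; elim: fs f => [|f' fs IH] f /=.
  rewrite /Tens linear_mext; apply: mext_eq => w /=.
  by rewrite /tens1 mextU scale1r /= mulr1.
by rewrite Tens_Delta_head IH.
Qed.

Lemma Tens_proj_word fs a : All fs (fun f => f [::] = 0) -> Tens fs (mext (@proj_word F n) a) = Tens fs a.
Proof.
move=> f0; rewrite /Tens linear_mext; apply: mext_eq => ws /=.
rewrite /proj_word; case: allP => [_|h]; first by rewrite mextU scale1r.
rewrite linear0; elim: ws fs f0 h => [|w ws IH] [|f fs] //=.
  by move=> _ [].
move=> [f0 fs0] h; case: (eqVneq w [::]) => [->|wn]; first by rewrite f0 mul0r.
rewrite -IH ?mulr0 // => h'; apply: h => x.
by rewrite inE => /orP[/eqP -> //|]; apply: h'.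
Qed.

Lemma Tens_deltam f fs a : All (f :: fs) (fun f => f [::] = 0) ->
  Tens (f :: fs) (deltam (size fs).+1 a) = mext (foldl conv f fs : W -> K^o) a.
Proof. by move=> h; rewrite /deltam Tens_proj_word // Tens_Deltam. Qed.

End Functionals.

(** * Pairings with words and their divisibility by [hbar] *)

Section Valuation.
Variables (F : fieldType) (n : nat).
Local Notation K := {poly F}.
Local Notation W := (word n).
Implicit Types (u v w gs : W).

(** In the rescaled letters [hbar t] the coproduct has all coefficients equal to 1. This is that
    fact for the letters [t], written without division. *)
Lemma dletter_wt (g : gen n) q : q \in dletter F g ->
  'X * q.1 = 'X^(size q.2.1 + size q.2.2) :> K.
Proof.
case: g => [[i j] r]; rewrite mem_cat !inE => /orP[/orP[]/eqP -> /=|].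
- by rewrite mulr1.
- by rewrite mulr1.
by case/allpairsP => -[k a] [_ _ ->].
Qed.

Lemma dword_wt w q : q \in dword F w ->
  'X^(size w) * q.1 = 'X^(size q.2.1 + size q.2.2) :> K.
Proof.
elim: w q => [|g w IH] q /=; first by rewrite inE => /eqP -> /=; rewrite mulr1.
case/allpairsP => -[p p'] /= [/dletter_wt hp /IH hp' ->] /=.
rewrite exprS !size_cat mulrACA hp hp' -exprD; congr ('X^_).
by rewrite addnACA.
Qed.

Lemma dvdX (p : K) : p.[0] = 0 -> 'X %| p.
Proof. by move=> p0; rewrite -['X]subr0 -polyC0 dvdp_XsubCl; apply/rootP. Qed.

Lemma Xexp_neq0 k : 'X^k != 0 :> K.
Proof. by rewrite -size_poly_eq0 size_polyXn. Qed.

Lemma dvdp_big (d : K) (I : eqType) (r : seq I) (P : pred I) (f : I -> K) :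
  (forall i, i \in r -> P i -> d %| f i) -> d %| \sum_(i <- r | P i) f i.
Proof.
move=> h; rewrite big_seq_cond; elim/big_ind: _ => [|x y|i /andP[]].
- exact: dvdp0.
- exact: dvdp_add.
exact: h.
Qed.

Definition redg (g : gen n) : W -> K := redf F g.1.1 g.1.2 g.2.
Definition conv_redg g gs : W -> K := foldl (@conv F n) (redg g) (map redg gs).

Lemma conv_redg_rcons g gs h : conv_redg g (rcons gs h) = conv (conv_redg g gs) (redg h).
Proof. by rewrite /conv_redg map_rcons foldl_rcons. Qed.

Lemma redg_dvd g w : 'X %| 'X^(size w) * redg g w.
Proof.
case: w => [|h w]; first by rewrite mulr0 dvdp0.
by rewrite /= exprS -mulrA dvdp_mulr.
Qed.

(** By [dword_wt] the factor [hbar^|w|] is distributed over the letters of both tensor factors. Each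
    functional vanishes on the empty word, so each one uses up at least one [hbar]. *)
Lemma conv_redg_dvd g gs w : 'X^((size gs).+1) %| 'X^(size w) * conv_redg g gs w.
Proof.
elim/last_ind: gs w => [|gs h IH] w; first exact: redg_dvd.
rewrite conv_redg_rcons size_rcons exprSr /conv mulr_sumr; apply: dvdp_big => q hq _.
by rewrite mulrA (dword_wt hq) exprD mulrACA dvdp_mul ?IH ?redg_dvd.
Qed.

Fixpoint splits w : seq (W * W) :=
  if w is g :: w' then
    [seq (g :: q.1, q.2) | q <- splits w'] ++ [seq (q.1, g :: q.2) | q <- splits w']
  else [:: ([::], [::])].

Lemma splits_perm w q : q \in splits w -> perm_eq (q.1 ++ q.2) w.
Proof.
elim: w q => [|g w IH] q /=; first by rewrite inE => /eqP ->.
rewrite mem_cat => /orP[] /mapP[q' /IH hq ->] /=; first by rewrite perm_cons.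
by rewrite -cat1s perm_catCA /= perm_cons.
Qed.

Lemma splits_nil w : (w, [::]) \in splits w.
Proof.
elim: w => [|g w IH] /=; first by rewrite inE.
by rewrite mem_cat; apply/orP; left; apply/mapP; exists (w, [::]).
Qed.

Lemma splits_letter w g : g \in w -> exists v, (v, [:: g]) \in splits w.
Proof.
elim: w => //= h w IH; rewrite inE => /orP[/eqP ->|/IH [v hv]].
  exists w; rewrite mem_cat; apply/orP; right; apply/mapP.
  by exists (w, [::]); first exact: splits_nil.
exists (h :: v); rewrite mem_cat; apply/orP; left; apply/mapP.
by exists (v, [:: g]).
Qed.

(* At hbar = 0 the generators are primitive, so only shuffles survive. *)
Lemma dword_at0 w (phi : W * W -> F) :
  \sum_(q <- dword F w) q.1.[0] * phi q.2 = \sum_(q <- splits w) phi q.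
Proof.
elim: w phi => [|g w IH] phi /=; first by rewrite !big_seq1 hornerC mul1r.
rewrite big_cat !big_map -!IH big_allpairs_dep.
case: g => [[i j] r]; rewrite /dletter big_cat /= !big_cons big_nil addr0.
rewrite [X in _ + X = _]big1_seq ?addr0 => [|p /andP[_]]; last first.
  case/allpairsP => a [_ _ ->]; rewrite big1 // => q _ /=.
  by rewrite hornerM hornerX !mul0r.
by congr (_ + _); apply: eq_bigr => q _; rewrite hornerM hornerC mul1r.
Qed.

(** Keeping track of natural numbers rules out cancellation: a sum is positive as soon as one term
    is. *)
Lemma sum_nat_pos (I : eqType) (r : seq I) (f : I -> F) (c : pred I) :
  (forall i, i \in r -> exists k, f i = k%:R /\ (0 < k)%N = c i) ->
  exists k, \sum_(i <- r) f i = k%:R /\ (0 < k)%N = has c r.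
Proof.
elim: r => [|i r IH] h; first by exists 0%N; rewrite big_nil.
have [k [fk ck]] := h i (mem_head _ _).
have [|k' [fk' ck']] := IH; first by move=> j jr; apply: h; rewrite inE jr orbT.
by exists (k + k')%N; rewrite big_cons fk fk' natrD addn_gt0 ck ck'.
Qed.

(** Induction on the last functional: at [hbar = 0] a splitting of [w] contributes only if its
    second part is exactly the letter [h], and the first part is then a word of the length required
    by the induction. *)
Lemma conv_redg_at0 g gs w : size w = (size gs).+1 ->
  exists k, (conv_redg g gs w).[0] = k%:R /\ (0 < k)%N = perm_eq (g :: gs) w.
Proof.
elim/last_ind: gs w => [|gs h IH] w.
  case: w => [|h [|]] // _; exists (g == h).
  rewrite /conv_redg /= /redg redf_letter -polyC_natr hornerC; split=> //.
  by rewrite lt0b; apply/eqP/idP => [-> //|]; move/(perm_small_eq (s2 := [:: h]) isT) => [->].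
rewrite size_rcons => sw.
rewrite conv_redg_rcons /conv.
have -> : (\sum_(q <- dword F w) q.1 * (conv_redg g gs q.2.1 * redg h q.2.2)).[0] =
  \sum_(q <- splits w) (conv_redg g gs q.1).[0] * (redg h q.2).[0].
  rewrite -dword_at0 horner_sum; apply: eq_bigr => q _.
  by rewrite !hornerM.
have [q hq|k [-> hk]] := @sum_nat_pos _ (splits w)
  (fun q => (conv_redg g gs q.1).[0] * (redg h q.2).[0])
  (fun q => perm_eq (g :: gs) q.1 && (q.2 == [:: h])).
  have := perm_size (splits_perm hq); rewrite size_cat sw.
  case: q hq => q1 [|x [|y q2]] hq /=.
  - by move=> _; exists 0%N; rewrite /redg redf_nil horner0 mulr0 andbF.
  - rewrite addn1 => -[/IH [k [-> hk]]]; exists (k * (h == x))%N.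
    rewrite /redg redf_letter -polyC_natr hornerC natrM; split=> //.
    by rewrite muln_gt0 hk lt0b eqseq_cons andbT [x == h]eq_sym.
  (* Here [q1] has fewer letters than there are functionals, so [conv_redg_dvd] leaves a factor
     [hbar] in its value, which vanishes at [0]. *)
  - move=> sq; exists 0%N; rewrite andbC eqseq_cons /= !andbF; split=> //.
    have lt : (size q1 < (size gs).+1)%N by move: sq => /=; lia.
    have := conv_redg_dvd g gs q1; rewrite -(subnKC lt) addSnnS exprD.
    rewrite dvdp_mul2l ?Xexp_neq0 // exprS => /(dvdp_trans (dvdp_mulr _ (dvdpp _))).
    rewrite -['X]subr0 -polyC0 dvdp_XsubCl => /rootP ->.
    by rewrite mul0r.
exists k; split=> //; rewrite hk; apply/hasP/idP => [[[q1 q2] hq /andP[/= h1 /eqP h2]]|hp].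
  rewrite -rcons_cons -cats1 (perm_trans _ (splits_perm hq)) //= h2.
  by rewrite -!cat_cons perm_cat2r.
have /splits_letter [v hv] : h \in w by rewrite -(perm_mem hp) -rcons_cons mem_rcons inE eqxx.
exists (v, [:: h]) => //=; rewrite eqxx andbT.
have := splits_perm hv; rewrite /= perm_sym => /(perm_trans hp).
by rewrite -rcons_cons -cats1 perm_cat2r.
Qed.

(** The numbers [H(g, w)]. With no functionals the counit appears, because [delta_0] is the
    counit. *)
Definition pairing gs : W -> K :=
  if gs is g :: gs' then conv_redg g gs' else fun w => eps F w.

Lemma pairing_dvd gs w : 'X^(size gs) %| 'X^(size w) * pairing gs w.
Proof. by case: gs => [|g gs]; rewrite /pairing ?dvd1p //; apply: conv_redg_dvd. Qed.

Lemma pairing_at0 gs w : size w = size gs ->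
  exists k, (pairing gs w).[0] = k%:R /\ (0 < k)%N = perm_eq gs w.
Proof.
case: gs => [|g gs]; last exact: conv_redg_at0.
by case: w => // _; exists 1%N; rewrite /= hornerC.
Qed.

Lemma redg_nil gs : All (map redg gs) (fun f => f [::] = 0).
Proof. by elim: gs. Qed.

Lemma Tens_pairing gs a : Tens (map redg gs) (deltam (size gs) a) = mext (pairing gs : W -> K^o) a.
Proof.
case: gs => [|g gs] /=; last first.
  by rewrite -(size_map redg) Tens_deltam //; apply: (redg_nil (g :: gs)).
rewrite /deltam Tens_proj_word // /Deltam /Tens linear_mext; apply: mext_eq => w /=.
by rewrite linearZ /= mextU scale1r /= -[LHS]/(_ * _) mulr1.
Qed.

Lemma kills_redg gs : All (map redg gs) (@kills F n).
Proof. by elim: gs => //= x s IH; split; first exact: kills_redf. Qed.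

Hypothesis charF : [pchar F] =i pred0.
Variable le : rel (gen n).
Hypotheses (le_trans : transitive le) (le_anti : antisymmetric le).

(** The extremal argument is run as a double induction: on the exponent of [hbar], then on the
    length of [w]. *)
Lemma valuation (a : {malg K[W]}) N :
  (forall w, ~~ sorted le w -> a@_w = 0) ->
  (forall gs, 'X^(size gs + N) %| (mext (pairing gs : W -> K^o) a : K)) ->
  forall w, 'X^(size w + N) %| a@_w.
Proof.
move=> a_sorted a_val.
pose D := \max_(w <- msupp a) size w.
have A0 w : 'X^(size w) %| 'X^D * a@_w.
  have [wa|] := msuppP; last by rewrite mulr0 dvdp0.
  by rewrite dvdp_mulr // dvdp_exp2l // /D (bigD1_seq w) //= ?leq_maxl // fset_uniq.
(* Multiplication by [hbar^D], where [D] bounds the lengths in the support, keeps all exponents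
   natural: [k = 0] is [A0], and [k = D + N] is the claim after cancelling [hbar^D]. *)
suff A k w : (k <= D + N)%N -> 'X^(size w + k) %| 'X^D * a@_w.
  move=> w; have := A (D + N)%N w (leqnn _).
  by rewrite addnCA exprD dvdp_mul2l ?Xexp_neq0.
elim: k w => [|k IHk] w; first by rewrite addn0.
move=> ltk; have {}IHk v := IHk v (ltnW ltk).
have [m] := ubnP (size w); elim: m w => // m IHm w; rewrite ltnS => wm.
have [wa|] := msuppP; last by rewrite mulr0 dvdp0.
have w_sorted : sorted le w.
  by apply/contraT => /a_sorted /eqP; rewrite mcoeff_eq0 wa.
(* A positive integer stays nonzero in characteristic 0, so the diagonal pairing is coprime to
   [hbar] and can be cancelled. *)
have Hw : ~~ root (pairing w w) 0.
  have [c [hc hc0]] := pairing_at0 (erefl (size w)).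
  rewrite rootE hc; move/pcharf0P: charF => ->.
  by rewrite -lt0n hc0.
have cop : coprimep 'X^(size w + k.+1) (pairing w w).
  by rewrite coprimep_expl // coprimep_sym coprimepX.
rewrite -(Gauss_dvdpl _ cop).
have := a_val w; rewrite /mext (bigD1_seq w) //=; last exact: fset_uniq.
move/(dvdp_mul (dvdpp 'X^D)) => sum_dvd.
have dvd1 : ('X^(size w + k.+1) : K) %| 'X^D * 'X^(size w + N).
  by rewrite -exprD dvdp_exp2l // addnCA leq_add2l.
set R := (X in _ + X) in sum_dvd.
have dvdR : ('X^(size w + k.+1) : K) %| 'X^D * R.
  rewrite /R mulr_sumr; apply: dvdp_big => v va vw.
  rewrite -[_ *: _]/(_ * _) mulrA.
  (* For shorter [v] the induction on length is completed by the powers of [hbar] in the pairing;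
     for longer [v] the previous exponent suffices. For equal lengths one [hbar] is missing, and the
     pairing supplies it because distinct sorted words are not rearrangements of each other. *)
  have [lt|gt|e] := ssrnat.ltngtP (size v) (size w).
  - have := dvdp_mul (IHm v (leq_trans lt wm)) (pairing_dvd w v).
    have -> : 'X^(size v + k.+1) * 'X^(size w) = 'X^(size v) * 'X^(size w + k.+1) :> K.
      by rewrite -!exprD; congr ('X^_); lia.
    by rewrite mulrCA dvdp_mul2l ?Xexp_neq0.
  - apply: dvdp_mulr; apply: dvdp_trans (IHk v); by rewrite dvdp_exp2l // addnS -addSn leq_add2r.
  have v_sorted : sorted le v.
    by apply/contraT => /a_sorted /eqP; rewrite mcoeff_eq0 va.
  rewrite addnS exprSr -e; apply: dvdp_mul => //; apply: dvdX.
  have [c [-> hc]] := pairing_at0 e.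
  have [-> //|c0] := posnP c; rewrite c0 in hc.
  by have := vw; rewrite (sorted_eq le_trans le_anti w_sorted v_sorted) ?eqxx.
have := dvdp_sub (dvdp_trans dvd1 sum_dvd) dvdR.
by rewrite -mulrBr addrK -[_ *: _]/(_ * _) mulrA.
Qed.

End Valuation.

(** * Compatibility of the coproduct with the relations *)

Section RTT.
Variables (R : pzRingType) (n : nat) (c : R).
Hypothesis cC : forall x : R, c * x = x * c.
Implicit Types (t : 'I_n -> 'I_n -> nat -> R) (i j k l p q : 'I_n).

(** A defect rather than an equation, since the relations will hold only modulo an ideal; [c] stands
    for [hbar]. *)
Definition rtt t i j k l r s : R :=
  (t i j r.+1 * t k l s - t k l s * t i j r.+1)
  - (t i j r * t k l s.+1 - t k l s.+1 * t i j r)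
  - c * (t k j r * t i l s - t k j s * t i l r).

Variables tl tr : 'I_n -> 'I_n -> nat -> R.
Hypothesis tlr : forall i j k l a b, tl i j a * tr k l b = tr k l b * tl i j a.
Hypothesis tl0 : forall i j, tl i j 0 = (i == j)%:R.
Hypothesis tr0 : forall i j, tr i j 0 = (i == j)%:R.

Definition cop i j r : R := \sum_p \sum_(a < r.+1) tl i p a * tr p j (r - a)%N.

Lemma cop_mul i j k l r s : cop i j r * cop k l s =
  \sum_p \sum_q \sum_(a < r.+1) \sum_(b < s.+1)
    tl i p a * tl k q b * (tr p j (r - a)%N * tr q l (s - b)%N).
Proof.
rewrite /cop mulr_suml; apply: eq_bigr => p _.
rewrite mulr_sumr; apply: eq_bigr => q _.
rewrite mulr_suml; apply: eq_bigr => a _.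
rewrite mulr_sumr; apply: eq_bigr => b _.
by rewrite mulrA -[_ * tl k q b]mulrA -tlr !mulrA.
Qed.

(** Multiplication by [z - w] shifts the two sums differently. The extra terms at [a = 0] or [b = 0]
    vanish, which brings both to one index range. *)
Lemma sum_shift (f : nat -> nat -> nat -> nat -> R) r s :
  (forall b a' b', f 0%N b a' b' = 0) -> (forall a a' b', f a 0%N a' b' = 0) ->
  \sum_(a < r.+2) \sum_(b < s.+1) f a b (r.+1 - a)%N (s - b)%N
  - \sum_(a < r.+1) \sum_(b < s.+2) f a b (r - a)%N (s.+1 - b)%N
  = \sum_(a < r.+1) \sum_(b < s.+1)
      (f a.+1 b (r - a)%N (s - b)%N - f a b.+1 (r - a)%N (s - b)%N).
Proof.
move=> f0 f0'; rewrite big_ord_recl big1 ?add0r => [|b _]; last exact: f0.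
rewrite -sumrB; apply: eq_bigr => a _; rewrite [X in _ - X]big_ord_recl f0' add0r.
by rewrite -sumrB.
Qed.

Lemma sum_rev (f : nat -> nat -> nat -> nat -> R) r s :
  \sum_(a < r.+1) \sum_(b < s.+1) f a b (r - a)%N (s - b)%N =
  \sum_(a < r.+1) \sum_(b < s.+1) f (r - a)%N (s - b)%N a b.
Proof.
rewrite (reindex_inj rev_ord_inj) /=; apply: eq_bigr => a _.
rewrite (reindex_inj rev_ord_inj) /=; apply: eq_bigr => b _.
by rewrite !subSS !subKn // -ltnS.
Qed.

Definition bra t i j k l a b := t i j a * t k l b - t k l b * t i j a.

Lemma bra0l t (t0 : forall i j, t i j 0%N = (i == j)%:R) i j k l b :
  bra t i j k l 0 b = 0.
Proof. by rewrite /bra t0 mulr_natl mulr_natr subrr. Qed.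

Lemma bra0r t (t0 : forall i j, t i j 0%N = (i == j)%:R) i j k l a :
  bra t i j k l a 0 = 0.
Proof. by rewrite /bra t0 mulr_natl mulr_natr subrr. Qed.

Definition fl i j k l p q a b a' b' :=
  bra tl i p k q a b * (tr p j a' * tr q l b').
Definition fR i j k l p q a b a' b' :=
  tl k q b' * tl i p a' * bra tr p j q l a b.

Lemma cop_bra i j k l r s : bra cop i j k l r s =
  \sum_p \sum_q \sum_(a < r.+1) \sum_(b < s.+1)
    (fl i j k l p q a b (r - a)%N (s - b)%N + fR i j k l p q a b (r - a)%N (s - b)%N).
Proof.
rewrite /bra !cop_mul [X in _ - X]exchange_big -sumrB; apply: eq_bigr => p _.
rewrite -sumrB; apply: eq_bigr => q _.
rewrite [X in _ - X]exchange_big -sumrB /=.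
under [RHS]eq_bigr do rewrite big_split /=.
rewrite [RHS]big_split /= [X in _ = _ + X](sum_rev (fun a b a' b' => fR i j k l p q a b a' b')).
rewrite -[RHS]big_split /=; apply: eq_bigr => a _.
rewrite -sumrB -big_split /=; apply: eq_bigr => b _.
rewrite /fl /fR /bra mulrBl mulrBr addrA.
by rewrite addrNK.
Qed.

Lemma rtt_cop_ring (k1 k2 x1 x2 l1 l2 y1 y2 g h : R) :
  k1 * g + h * l1 - (k2 * g + h * l2) - c * (x1 * g - x2 * g + h * y1 - h * y2) =
  (k1 - k2 - c * (x1 - x2)) * g + h * (l1 - l2 - c * (y1 - y2)).
Proof.
rewrite -mulrBl -[X in c * X]addrA -[X in c * (_ + X)]mulrBr mulrDr !opprD.
rewrite [X in X + _ = _]addrACA -mulrBl -mulrBr addrACA mulrA -mulrBl.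
by rewrite [c * (h * _)]mulrA [c * h]cC -mulrA -mulrBr.
Qed.

Lemma rtt_cop i j k l r s : rtt cop i j k l r s =
  \sum_p \sum_q \sum_(a < r.+1) \sum_(b < s.+1)
   (rtt tl i p k q a b * (tr p j (r - a)%N * tr q l (s - b)%N)
   + tl k q (s - b)%N * tl i p (r - a)%N * rtt tr p j q l a b).
Proof.
rewrite /rtt -/(bra cop i j k l _ _) -/(bra cop i j k l r _) !cop_bra.
pose f i j k l p q a b a' b' := fl i j k l p q a b a' b' + fR i j k l p q a b a' b'.
pose A p q a b := tl k p a * tl i q b * (tr p j (r - a)%N * tr q l (s - b)%N).
pose D p q a b := tl k q (s - b)%N * tl i p (r - a)%N * (tr q j b * tr p l a).
pose B p q a b := tl k p b * tl i q a * (tr p j (r - a)%N * tr q l (s - b)%N).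
pose C p q a b := tl k q (s - b)%N * tl i p (r - a)%N * (tr q j a * tr p l b).
have BC : \sum_p \sum_q \sum_(a < r.+1) \sum_(b < s.+1) B p q a b =
          \sum_p \sum_q \sum_(a < r.+1) \sum_(b < s.+1) C p q a b.
  rewrite exchange_big; apply: eq_bigr => q _; apply: eq_bigr => p _ /=.
  exact: (sum_rev (fun a b a' b' => tl k p b * tl i q a * (tr p j a' * tr q l b'))).
have Deltam : cop k j s * cop i l r =
    \sum_p \sum_q \sum_(a < r.+1) \sum_(b < s.+1) D p q a b.
  rewrite cop_mul exchange_big; apply: eq_bigr => q _; apply: eq_bigr => p _ /=.
  rewrite exchange_big /=.
  exact: (sum_rev (fun a b a' b' => tl k p b * tl i q a * (tr p j b' * tr q l a'))).
(* The sums of [B] and [C] agree after exchanging [p], [q] and reversing [a], [b]. Inserting them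
   splits [A - D] into [A - B], which belongs to the left defect, and [C - D], which belongs to the
   right one. *)
have -> : cop k j r * cop i l s - cop k j s * cop i l r =
  \sum_p \sum_q \sum_(a < r.+1) \sum_(b < s.+1)
    (A p q a b - B p q a b + C p q a b - D p q a b).
  rewrite Deltam cop_mul -[LHS]addr0.
  rewrite -[X in _ + X](subrr (\sum_p \sum_q \sum_(a < r.+1) \sum_(b < s.+1) C p q a b)).
  rewrite -{2}BC.
  rewrite -!sumrB -big_split; apply: eq_bigr => p _ /=.
  rewrite -!sumrB -big_split; apply: eq_bigr => q _ /=.
  rewrite -!sumrB -big_split; apply: eq_bigr => a _ /=.
  rewrite -!sumrB -big_split; apply: eq_bigr => b _ /=.
  by rewrite addrAC [C _ _ _ _ - _]addrC addrA.
rewrite -sumrB mulr_sumr -sumrB; apply: eq_bigr => p _ /=.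
rewrite -sumrB mulr_sumr -sumrB; apply: eq_bigr => q _ /=.
rewrite (sum_shift (f := f i j k l p q)) => [|b a' b'|a a' b']; last 2 first.
- by rewrite /f /fl /fR !bra0l // mul0r mulr0 addr0.
- by rewrite /f /fl /fR !bra0r // mul0r mulr0 addr0.
rewrite mulr_sumr -sumrB; apply: eq_bigr => a _ /=.
rewrite mulr_sumr -sumrB; apply: eq_bigr => b _ /=.
rewrite /f /fl /fR /A /B /C /D -!/(bra _ _ _ _ _ _ _).
exact: rtt_cop_ring.
Qed.
End RTT.

(** * The divided relations under a coproduct *)

Section AbstractCoproduct.
Variables (F : fieldType) (n : nat).
Local Notation K := {poly F}.
Local Notation W := (word n).
Variable A : lalgType K.
Hypothesis scAr : forall (c : K) (x y : A), c *: (x * y) = x * (c *: y).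
Hypothesis torsion_free : forall (c : K) (x : A), c != 0 -> c *: x = 0 -> x = 0.
Implicit Types (i j k l p q : 'I_n) (x y : A) (h : W -> A).

Definition Tcoef h i j r : A :=
  if r is r'.+1 then 'X *: h [:: (i, j, r')] else (i == j)%:R.

Lemma comm_natl (b : nat) x : b%:R * x - x * b%:R = 0.
Proof. by rewrite mulr_natl mulr_natr subrr. Qed.
Lemma comm_natr (b : nat) x : x * b%:R - b%:R * x = 0.
Proof. by rewrite mulr_natl mulr_natr subrr. Qed.
Lemma XX_mul x y : ('X *: x) * ('X *: y) = 'X^2 *: (x * y).
Proof. by rewrite -scAr -scalerAl scalerA -expr2. Qed.
Lemma nat_scalel (b : nat) x : b%:R * ('X *: x) = 'X *: ((b%:R : K) *: x).
Proof. by rewrite mulr_natl scaler_nat scalerMnr. Qed.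
Lemma nat_scaler (b : nat) x : ('X *: x) * b%:R = 'X *: ((b%:R : K) *: x).
Proof. by rewrite mulr_natr scaler_nat scalerMnr. Qed.

(** Multiplying by [hbar^2] returns to the defect for the elements [hbar t], the form to which
    [rtt_cop] applies. *)
Lemma scale_X2_rel h i j k l r s : (forall u v, h (u ++ v) = h u * h v) ->
  'X^2 *: ext_rel h (i, j, k, l, r, s) = rtt ('X%:A : A) (Tcoef h) i j k l r s.
Proof.
move=> hM.
have h2 g g' : h [:: g; g'] = h [:: g] * h [:: g'] by rewrite -hM.
rewrite /rtt mulr_algl /ext_rel.
case: r s => [|r] [|s]; rewrite /Tcoef.
- by rewrite ext_rel00 comm_natl comm_natr !subrr !scaler0 subrr.
- rewrite ext_rel0S !h2 comm_natl subr0 nat_scalel nat_scaler !XX_mul.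
  by rewrite -!scalerBr scalerA -expr2 -scalerBr.
- rewrite ext_relS0 !h2 comm_natr sub0r nat_scalel nat_scaler !XX_mul.
  by rewrite [LHS]scalerBr scalerN -!scalerBr scalerA -expr2.
- rewrite ext_relSS !h2 !XX_mul.
  rewrite -!scalerBr [LHS]scalerBr; congr (_ - _); rewrite !scalerA.
  by congr (_ *: _); exact: mulrC.
Qed.

Variables hl hr D : W -> A.
Hypotheses (hlM : forall u v, hl (u ++ v) = hl u * hl v)
           (hrM : forall u v, hr (u ++ v) = hr u * hr v)
           (DM : forall u v, D (u ++ v) = D u * D v).
Hypothesis hlr : forall u v, hl u * hr v = hr v * hl u.
Hypothesis D_letter : forall i j r, D [:: (i, j, r)] =
  hl [:: (i, j, r)] + hr [:: (i, j, r)] +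
  'X *: \sum_k \sum_(a < r) hl [:: (i, k, val a)] * hr [:: (k, j, (r.-1 - a)%N)].

Lemma sum_delta_l i (f : 'I_n -> A) : \sum_k (i == k)%:R * f k = f i.
Proof.
rewrite (bigD1 i) //= eqxx mul1r big1 ?addr0 // => k /negPf ki.
by rewrite eq_sym ki mul0r.
Qed.

Lemma sum_delta_r i (f : 'I_n -> A) : \sum_k f k * (k == i)%:R = f i.
Proof.
rewrite (bigD1 i) //= eqxx mulr1 big1 ?addr0 // => k /negPf ki.
by rewrite ki mulr0.
Qed.

Lemma Tcoef_cop i j r : Tcoef D i j r = cop (Tcoef hl) (Tcoef hr) i j r.
Proof.
case: r => [|r]; rewrite /cop.
  under eq_bigr do rewrite big_ord1.
  by rewrite (sum_delta_l i (fun k => (k == j)%:R)).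
(* The first and last terms contain a scalar [T^(0)] and give the primitive part; the inner ones
   carry [hbar^2]. *)
under eq_bigr => k _ do rewrite big_ord_recl big_ord_recr /= subnn.
rewrite !big_split /= (sum_delta_l i (fun k => 'X *: hr [:: (k, j, r)])).
rewrite (sum_delta_r j (fun k => 'X *: hl [:: (i, k, r)])) D_letter.
rewrite !scalerDr [X in X + _ = _]addrC -addrA; congr (_ + _).
rewrite addrC; congr (_ + _); rewrite scalerA -expr2 scaler_sumr.
apply: eq_bigr => k _; rewrite scaler_sumr; apply: eq_bigr => a _.
have -> : (r.+1 - bump 0 a)%N = (r.-1 - a).+1 by have := ltn_ord a; rewrite /bump; lia.
by rewrite -XX_mul.
Qed.

Lemma Tcoef_comm i j k l a b : Tcoef hl i j a * Tcoef hr k l b = Tcoef hr k l b * Tcoef hl i j a.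
Proof.
case: a b => [|a] [|b]; rewrite /Tcoef.
- by rewrite mulr_natl mulr_natr.
- by rewrite mulr_natl mulr_natr.
- by rewrite mulr_natl mulr_natr.
by rewrite !XX_mul hlr.
Qed.

(* The relations were divided by hbar^2, but hbar^2 can be cancelled again here. *)
Lemma rel_cop i j k l r s : ext_rel D (i, j, k, l, r, s) =
  \sum_p \sum_q \sum_(a < r.+1) \sum_(b < s.+1)
   (ext_rel hl (i, p, k, q, val a, val b)
      * (Tcoef hr p j (r - a)%N * Tcoef hr q l (s - b)%N)
   + Tcoef hl k q (s - b)%N * Tcoef hl i p (r - a)%N
      * ext_rel hr (p, j, q, l, val a, val b)).
Proof.
apply/eqP; rewrite -subr_eq0; apply/eqP.
apply: (@torsion_free 'X^2); first by rewrite -size_poly_eq0 size_polyXn.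
have cC (x : A) : 'X%:A * x = x * 'X%:A by rewrite mulr_algl -scAr mulr1.
apply/eqP; rewrite scalerBr subr_eq0 scale_X2_rel //; apply/eqP.
transitivity (rtt 'X%:A (cop (Tcoef hl) (Tcoef hr)) i j k l r s).
  by rewrite /rtt !Tcoef_cop.
rewrite (rtt_cop cC Tcoef_comm) //.
rewrite scaler_sumr; apply: eq_bigr => p _; rewrite scaler_sumr; apply: eq_bigr => q _.
rewrite scaler_sumr; apply: eq_bigr => a _; rewrite scaler_sumr; apply: eq_bigr => b _.
by rewrite scalerDr scalerAl scale_X2_rel // scAr scale_X2_rel.
Qed.

(** Each term of [rel_cop] is a multiple of a relation for [hl] or for [hr], so membership in a
    two-sided ideal passes from these to [D]. *)
Lemma rel_cop_ind (Q : A -> Prop) : Q 0 -> (forall x y, Q x -> Q y -> Q (x + y)) ->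
  (forall x y z, Q y -> Q (x * y * z)) ->
  (forall ix, Q (ext_rel hl ix)) -> (forall ix, Q (ext_rel hr ix)) ->
  forall ix, Q (ext_rel D ix).
Proof.
move=> Q0 QD QM Ql Qr [[[[[i j] k] l] r] s]; rewrite rel_cop.
have Qsum (I : finType) (f : I -> A) : (forall t, Q (f t)) -> Q (\sum_t f t).
  by move=> Qf; apply: big_ind => // x y; apply: QD.
apply: (Qsum) => p; apply: (Qsum) => q; apply: (Qsum) => a; apply: Qsum => b.
apply: QD; first by rewrite -[X in X * _]mul1r; apply: QM.
by rewrite -[X in Q X]mulr1; apply: QM.
Qed.

Lemma ext_mul h v x y : x * ext h v * y = ext (fun w => x * h w * y) v.
Proof.
rewrite /ext mulr_sumr mulr_suml; apply: eq_bigr => p _.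
by rewrite -scAr -scalerAl.
Qed.

End AbstractCoproduct.

(** * Descent of the coproduct and of [delta_m] to the Yangian *)

Definition pmon n := (word n * word n)%type.
HB.instance Definition _ n := Choice.on (pmon n).

Section PairMonoid.
Variable n : nat.
Definition pmone : pmon n := ([::], [::]).
(** With this product [{malg K[pmon n]}] is the tensor square of the free algebra, on which the
    coproduct is multiplicative. *)
Definition pmmul (p q : pmon n) : pmon n := (p.1 ++ q.1, p.2 ++ q.2).

Fact pmmulA : associative pmmul.
Proof. by move=> p q r; rewrite /pmmul /= !catA. Qed.
Fact pmmul1m : left_id pmone pmmul.
Proof. by case. Qed.
Fact pmmulm1 : right_id pmone pmmul.
Proof. by case=> u v; rewrite /pmmul /= !cats0. Qed.
Fact pm_unit p q : pmmul p q = pmone -> p = pmone /\ q = pmone.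
Proof. by case: p q => [[|? ?] [|? ?]] [[|? ?] [|? ?]]. Qed.

HB.instance Definition _ :=
  Choice_isMonomialDef.Build (pmon n) pmmulA pmmul1m pmmulm1 pm_unit.
End PairMonoid.

Lemma malg_ind (R : comNzRingType) (B : choiceType) (Q : {malg R[B]} -> Prop) :
  Q 0 -> (forall x y, Q x -> Q y -> Q (x + y)) -> (forall c x, Q x -> Q (c *: x)) ->
  (forall b, Q << b >>) -> forall x, Q x.
Proof.
move=> Q0 QD QZ QU x; rewrite (monalgE x); apply: big_ind => // b _.
by rewrite -scale_malgU; apply: QZ.
Qed.

Lemma mulr_regroup (R : pzRingType) (x' x z y y' : R) :
  x' * (x * z * y) * y' = (x' * x) * z * (y * y').
Proof. by rewrite !mulrA. Qed.

Section MalgScale.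
Variables (M : monomType) (R : comNzRingType).
Implicit Types x y : {malg R[M]}.

Lemma malg_scalerAr (c : R) x y : c *: (x * y) = x * (c *: y).
Proof.
rewrite (malgMEw (fsubset_refl _) (msuppZ_le c y)) malgME scaler_sumr.
apply: eq_bigr => k _; rewrite scaler_sumr; apply: eq_bigr => l _.
by rewrite mcoeffZ -scale_malgU scalerA mulrCA scale_malgU.
Qed.

Lemma malgU_mul (c d : R) (k l : M) :
  << c *g k >> * << d *g l >> = << c * d *g mmul k l >> :> {malg R[M]}.
Proof. exact: fgmulUU. Qed.

End MalgScale.

Section Coproduct.
Variables (F : fieldType) (n : nat).
Local Notation K := {poly F}.
Local Notation W := (word n).
Local Notation T := {malg K[seq W]}.
Local Notation P := {malg K[pmon n]}.
Implicit Types (i j k l : 'I_n) (u v w : W) (ix : relidx n).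

Definition inl2 w : P := << (w, [::]) : pmon n >>.
Definition inr2 w : P := << ([::], w) : pmon n >>.
Definition Delta w : P := ext (fun q : W * W => << (q : pmon n) >>) (dword F w).

Lemma inl2_cat u v : inl2 (u ++ v) = inl2 u * inl2 v.
Proof. by rewrite malgU_mul mulr1. Qed.
Lemma inr2_cat u v : inr2 (u ++ v) = inr2 u * inr2 v.
Proof. by rewrite malgU_mul mulr1. Qed.
Lemma inlr2 u v : inl2 u * inr2 v = inr2 v * inl2 u.
Proof. by rewrite !malgU_mul /mmul /= /pmmul /= !cats0. Qed.

Definition cop_gen (g : gen n) : P := ext (fun q : W * W => << (q : pmon n) >>) (dletter F g).

Lemma Delta_cons g w : Delta (g :: w) = cop_gen g * Delta w.
Proof.
rewrite /Delta /= /ext big_allpairs_dep /cop_gen /ext mulr_suml; apply: eq_bigr => p _.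
rewrite mulr_sumr; apply: eq_bigr => q _ /=.
by rewrite -malg_scalerAr -scalerAl malgU_mul mulr1 scalerA mulrC.
Qed.

Lemma Delta_nil : Delta [::] = 1.
Proof. by rewrite /Delta /ext big_seq1 scale1r. Qed.

Lemma Delta_cat u v : Delta (u ++ v) = Delta u * Delta v.
Proof.
elim: u => [|g u IH]; first by rewrite Delta_nil mul1r.
rewrite cat_cons Delta_cons IH Delta_cons; exact: mulrA.
Qed.

Lemma malg_torsion_free (c : K) (x : P) : c != 0 -> c *: x = 0 -> x = 0.
Proof.
move=> c0 /malgP cx; apply/malgP => k; apply/eqP; have := cx k.
by rewrite mcoeffZ mcoeff0 => /eqP; rewrite mulf_eq0 (negPf c0).
Qed.

Lemma Delta_letter i j r : Delta [:: (i, j, r)] =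
  inl2 [:: (i, j, r)] + inr2 [:: (i, j, r)] +
  'X *: \sum_k \sum_(a < r) inl2 [:: (i, k, val a)] * inr2 [:: (k, j, (r.-1 - a)%N)].
Proof.
rewrite Delta_cons Delta_nil.
rewrite mulr1 /cop_gen ext_cat ext_pair1 ext_allpairs; congr (_ + _ *: _).
rewrite big_enum; apply: eq_bigr => k _.
rewrite -[X in iota _ X]subn0 -/(index_iota 0 r) big_mkord.
by apply: eq_bigr => a _; rewrite malgU_mul mulr1.
Qed.

Definition tcons post (q : pmon n) : T := << q.1 :: q.2 :: post >>.

(** Quantifying over [x] and [y] builds closure under two-sided multiplication into the predicate,
    as [rel_cop_ind] requires; [post] holds the remaining tensor factors. *)
Definition Jtens post (z : P) :=
  forall x y, inJm (size post).+2 (mext (tcons post) (x * z * y)).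

Lemma Jtens_U post (f : W -> pmon n) ix :
  (forall k l : pmon n,
     inJm (size post).+2 (ext_rel (fun p => tcons post (mmul (mmul k (f p)) l)) ix)) ->
  Jtens post (ext_rel (fun p => << f p >>) ix).
Proof.
move=> h x y; pose Q x y := inJm (size post).+2
  (mext (tcons post) (x * ext_rel (fun p => << f p >>) ix * y : P)).
suff: Q x y by [].
elim/malg_ind: x; rewrite /Q; last move=> k.
- by rewrite !mul0r linear0; apply: inJm_zero.
- by move=> x x'; rewrite !mulrDl linearD; apply: inJm_add.
- by move=> c x; rewrite -!scalerAl linearZ; apply: inJm_scale.
elim/malg_ind: y; last move=> l.
- by rewrite !mulr0 linear0; apply: inJm_zero.
- by move=> y y'; rewrite !mulrDr linearD; apply: inJm_add.
- by move=> c y; rewrite -malg_scalerAr linearZ; apply: inJm_scale.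
have := @ext_mul F n P (@malg_scalerAr (pmon n : monomType) K) (fun p => << f p >>)
  (Defs.rel F ix) << k >> << l >>.
rewrite /ext_rel => ->; rewrite linear_ext.
rewrite (eq_ext (g := fun p => tcons post (mmul (mmul k (f p)) l))) => [|p]; first exact: h.
by rewrite /= !malgU_mul !mulr1 mextU scale1r.
Qed.

Lemma Jtens_inl post ix : Jtens post (ext_rel inl2 ix).
Proof.
apply: Jtens_U => k l; have := @inJm_gen F n (size post).+2 [::] k.1 ix l.1 ((k.2 ++ l.2) :: post).
move=> /(_ erefl) h; rewrite /ext_rel.
rewrite (eq_ext (g := fun p => << [::] ++ (k.1 ++ p ++ l.1) :: (k.2 ++ l.2) :: post >>)) // => p.
by rewrite /tcons /mmul /= /pmmul /= cats0 catA.
Qed.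

Lemma Jtens_inr post ix : Jtens post (ext_rel inr2 ix).
Proof.
apply: Jtens_U => k l; have := @inJm_gen F n (size post).+2 [:: k.1 ++ l.1] k.2 ix l.2 post.
move=> /(_ erefl) h; rewrite /ext_rel.
rewrite (eq_ext (g := fun p => << [:: k.1 ++ l.1] ++ (k.2 ++ p ++ l.2) :: post >>)) // => p.
by rewrite /tcons /mmul /= /pmmul /= cats0 catA.
Qed.

Lemma Jtens_Delta post ix : Jtens post (ext_rel Delta ix).
Proof.
have scAr := @malg_scalerAr (pmon n : monomType) K.
have ind := @rel_cop_ind F n P scAr malg_torsion_free inl2 inr2 Delta
  inl2_cat inr2_cat Delta_cat inlr2.
apply: (ind Delta_letter (Jtens post)).
- by move=> x y; rewrite mulr0 mul0r linear0; apply: inJm_zero.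
- move=> z z' hz hz' x y; rewrite mulrDr mulrDl linearD; apply: inJm_add; [exact: hz | exact: hz'].
- by move=> x z y hz x' y'; rewrite mulr_regroup; apply: hz.
- exact: Jtens_inl.
exact: Jtens_inr.
Qed.

Lemma Delta_head_Delta w ws : @Delta_head F n (w :: ws) = mext (tcons ws) (Delta w).
Proof.
rewrite /Delta linear_ext; apply: eq_ext => q.
by rewrite /= mextU scale1r.
Qed.

Lemma ext_exchange (V : lmodType K) B B' (f : B -> B' -> V) (x : vec F B) (y : vec F B') :
  ext (fun b => ext (f b) y) x = ext (fun b' => ext (f^~ b') x) y.
Proof.
rewrite /ext; under eq_bigr do rewrite scaler_sumr.
rewrite exchange_big; apply: eq_bigr => q _; rewrite scaler_sumr; apply: eq_bigr => p _.
by rewrite !scalerA mulrC.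
Qed.

Lemma inJm_Delta_head m a : inJm m a -> inJm m.+1 (mext (@Delta_head F n) a).
Proof.
apply: (inJm_ind (V := T) (P := inJm m.+1) (L := mext (@Delta_head F n))); first exact: inJm_zero.
- by move=> x y; apply: inJm_add.
- by move=> c x; apply: inJm_scale.
move=> [[[[pre u] ix] v] post] /= <-; rewrite /jelt mext_mal ext_jgen.
case: pre => [|w pre].
  have -> : ext_rel (fun p => @Delta_head F n ([::] ++ (u ++ p ++ v) :: post)) ix =
            mext (tcons post) (Delta u * ext_rel Delta ix * Delta v).
    have := @ext_mul F n P (@malg_scalerAr (pmon n : monomType) K) Delta
      (Defs.rel F ix) (Delta u) (Delta v).
    rewrite /ext_rel => ->; rewrite linear_ext; apply: eq_ext => p.
    by rewrite cat0s Delta_head_Delta !Delta_cat mulrA.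
  exact: Jtens_Delta.
(* The relation lies beyond the first factor: splitting [w] does not touch it. *)
by rewrite /ext_rel ext_exchange; apply: inJm_ext => q; apply: (@inJm_gen F n _ (q.1 :: q.2 :: pre)).
Qed.

Lemma inJm_proj_word m a : inJm m a -> inJm m (mext (@proj_word F n) a).
Proof.
apply: (inJm_ind (V := T) (P := inJm m) (L := mext (@proj_word F n))); first exact: inJm_zero.
- by move=> x y; apply: inJm_add.
- by move=> c x; apply: inJm_scale.
move=> [[[[pre u] ix] v] post] /= <-; rewrite /jelt mext_mal ext_jgen.
have [h|h] := boolP (all (fun w => w != [::]) (pre ++ post)); last first.
  rewrite (_ : ext_rel _ _ = 0); first exact: inJm_zero.
  rewrite /ext_rel /ext big1 // => p _; rewrite /proj_word.
  move: h; rewrite !all_cat /= => /nandP[/negPf ->|/negPf ->].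
    by rewrite scaler0.
  by rewrite !andbF scaler0.
(* With the other factors nonempty, the projection removes only the terms equal to [z]. Their total
   coefficient is the counit of the relation, which is [0]. *)
pose z : T := << pre ++ [::] :: post >>.
have -> : ext_rel (fun p => @proj_word F n (pre ++ (u ++ p ++ v) :: post)) ix =
  ext_rel (fun p => << pre ++ (u ++ p ++ v) :: post >>) ix -
  ext_rel (fun p => ((u ++ p ++ v == [::])%:R : K) *: z) ix.
  rewrite /ext_rel /ext -sumrB; apply: eq_bigr => p _; rewrite -scalerBr; congr (_ *: _).
  move: h; rewrite /proj_word /z !all_cat /= => /andP[-> ->]; rewrite andbT.
  by case: eqP => [->|]; rewrite ?scale1r ?scale0r ?subrr ?subr0.
rewrite (_ : ext_rel (fun p => _ *: z) ix = 0) ?subr0; first exact: inJm_gen.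
have := @kills_eps F n u ix v; rewrite /ext_rel /ext => k0.
transitivity ((\sum_(p <- Defs.rel F ix)
   p.1 * (u ++ p.2 ++ v == [::])%:R) *: z); last by rewrite [X in X *: _]k0 scale0r.
by rewrite scaler_suml; apply: eq_bigr => p _; rewrite scalerA.
Qed.

(* Delta and id - eps descend to the Yangian. *)
Lemma inJm_deltam m (a : {malg K[W]}) : @inIm F n a -> inJm m (@deltam F n m a).
Proof.
move=> Ia; apply: inJm_proj_word; case: m => [|m]; last first.
  by rewrite /Deltam; elim: m => [|m IH] //=; apply: inJm_Delta_head.
pose e (w : W) : K := (w == [::])%:R.
have e0 : mext (e : W -> K^o) a = 0.
  by rewrite -(Tens_Deltam e [::]); apply: Tens_inJm Ia; split=> //; apply: kills_eps.
rewrite (_ : Deltam 0 a = 0); first exact: inJm_zero.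
transitivity (mext (e : W -> K^o) a *: (<< [::] : seq W >> : T)); last first.
  by rewrite e0 scale0r.
by rewrite -mext_scaler; apply: mext_eq => -[].
Qed.

End Coproduct.

(** * Straightening and the dual *)

Section Generation.
Variables (F : fieldType) (n : nat).
Local Notation K := {poly F}.
Local Notation W := (word n).
Local Notation T := {malg K[seq W]}.
Local Notation M := {malg K[W]}.
Implicit Types (a b : M) (u v w : W).

Definition tlen (ws : seq W) : nat := sumn (map size ws).
(** Combinations of tensors in the letters [hbar t]: every letter brings a factor [hbar]. *)
Definition graded m (x : vec F (seq W)) :=
  forall p, p \in x -> size p.2 = m /\ 'X^(tlen p.2) %| p.1.

Lemma graded_dtens m x : graded m x -> graded m.+1 (dtens x).
Proof.
move=> gx p /flatten_mapP[[c [|w ws]] //= hx /mapP[q hq ->]] /=.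
have [<- hc] := gx _ hx; split=> //=.
rewrite /tlen /= addnA exprD -(dword_wt hq) mulrAC -exprD.
by rewrite dvdp_mul.
Qed.

Lemma graded_Deltan m w : graded m (Deltan m (pbw F w)).
Proof.
case: m => [|m] /=; first by move=> p; rewrite inE => /eqP -> /=; rewrite dvd1p.
elim: m => [|m IH] /=; last exact: graded_dtens.
by move=> p; rewrite inE => /eqP ->; split=> //=; rewrite /tlen /= addn0.
Qed.

Lemma tlen_ge ws : all (fun w : W => w != [::]) ws -> (size ws <= tlen ws)%N.
Proof.
elim: ws => //= w ws IH /andP[hw /IH]; rewrite /tlen /=.
by case: w hw => //= g w _ h; rewrite addSn ltnS (leq_trans h) // leq_addl.
Qed.

(** After the projection all [m] factors are nonempty, so each term has at least [m] letters and its
    coefficient can be divided by [hbar^m]. *)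
Lemma inDG_pbw w : inDG (mal (pbw F w)).
Proof.
move=> m; exists (mal [seq (p.1 %/ 'X^m, p.2) | p <- deltan m (pbw F w)]).
rewrite /= -mal_deltan (_ : _ - _ = 0); first exact: inJm_zero.
apply/eqP; rewrite subr_eq0; apply/eqP.
rewrite /mal /ext big_map scaler_sumr; apply: eq_big_seq => p /=.
rewrite mem_filter => /andP[/tlen_ge hp /graded_Deltan[<- hdvd]].
by rewrite scalerA mulrC divpK // (dvdp_trans _ hdvd) // dvdp_exp2l.
Qed.

Lemma inDG_zero : inDG (0 : M).
Proof. by move=> m; exact/modulo_zero/inJm_zero. Qed.

Lemma inDG_add a b : inDG a -> inDG b -> inDG (a + b).
Proof.
move=> ha hb m; apply: modulo_add (ha m) (hb m).
exact: inJm_add.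
Qed.

Lemma inDG_scale c a : inDG a -> inDG (c *: a).
Proof.
move=> ha m; apply: modulo_scale (ha m).
exact: inJm_scale.
Qed.

Lemma inDG_inIm a b : inIm (a - b) -> inDG b -> inDG a.
Proof.
move=> hab hb m; apply: modulo_sub (hb m).
  exact: inJm_add.
exact: inJm_deltam.
Qed.

Lemma inDG_lincomb l : inDG (mal (lincomb (@pbw F n) l)).
Proof.
rewrite /mal ext_lincomb; apply: big_ind; first exact: inDG_zero.
- exact: inDG_add.
by move=> p _; apply/inDG_scale/inDG_pbw.
Qed.

Lemma inIm_gen u v ix : @inIm F n (ext_rel (fun p => << u ++ p ++ v >>) ix).
Proof.
rewrite /inIm /ext_rel linear_ext.
rewrite (eq_ext (g := fun p => << [::] ++ (u ++ p ++ v) :: [::] >>)); first exact: inJm_gen.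
by move=> p /=; rewrite mextU scale1r.
Qed.

Lemma inIm_zero : @inIm F n 0.
Proof. by rewrite /inIm linear0; apply: inJm_zero. Qed.

Lemma inIm_add a b : inIm a -> inIm b -> inIm (a + b).
Proof. by rewrite /inIm linearD; apply: inJm_add. Qed.

Lemma inIm_scale c a : inIm a -> inIm (c *: a).
Proof. by rewrite /inIm linearZ; apply: inJm_scale. Qed.

Definition span (P : pred W) a :=
  exists l : vec F W, all (fun p => P p.2) l /\ inIm (a - mal l).

Lemma span_word (P : pred W) w : P w -> span P << w >>.
Proof.
move=> Pw; exists [:: (1, w)]; split; first by rewrite /= Pw.
by rewrite /mal /ext big_seq1 scale1r subrr; apply: inIm_zero.
Qed.

Lemma span_zero P : span P 0.
Proof. by exists [::]; split=> //; rewrite /mal /ext big_nil subrr; apply: inIm_zero. Qed.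

Lemma span_add P a b : span P a -> span P b -> span P (a + b).
Proof.
move=> [l [hl al]] [l' [hl' bl]]; exists (l ++ l'); split; first by rewrite all_cat hl.
by rewrite /mal ext_cat opprD addrACA; apply: inIm_add.
Qed.

Lemma span_scale P c a : span P a -> span P (c *: a).
Proof.
move=> [l [hl al]]; exists (vscale c l); split; first by rewrite all_map.
by rewrite mal_scale -scalerBr; apply: inIm_scale.
Qed.

Lemma span_sub P a b : span P a -> span P b -> span P (a - b).
Proof. by move=> ha hb; have := span_add ha (span_scale (-1) hb); rewrite scaleN1r. Qed.

Lemma span_inIm P a b : inIm (a - b) -> span P b -> span P a.
Proof.
move=> hab [l [hl bl]]; exists l; split=> //.
by have := inIm_add hab bl; rewrite subrKA.
Qed.

Lemma span_trans (P Q : pred W) a : (forall w, P w -> span Q << w >>) -> span P a -> span Q a.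
Proof.
move=> PQ [l [hl al]]; apply: span_inIm al _.
elim: l hl => [|p l IH] /=; first by rewrite /mal /ext big_nil; move=> _; exact: span_zero.
move=> /andP[hp /IH hl]; rewrite /mal /ext big_cons; apply: span_add => //.
by apply/span_scale/PQ.
Qed.

(** The degree in which [t^(r)] has degree [r]; the successor accounts for indices starting at 0. *)
Definition wt w : nat := sumn (map (fun g : gen n => g.2.+1) w).

Lemma wt_cat u v : wt (u ++ v) = (wt u + wt v)%N.
Proof. by rewrite /wt map_cat sumn_cat. Qed.

(* [t^(1), t^(s)] is linear in the t's, and the relations trade
   [t^(r+1), t^(s)] for [t^(r), t^(s+1)] up to terms of smaller weight. *)
Lemma comm_low u v i j k l r s :
  span (fun w => wt w < wt u + wt v + (r.+1 + s.+1))%N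
    (<< u ++ [:: (i, j, r); (k, l, s)] ++ v >> -
     << u ++ [:: (k, l, s); (i, j, r)] ++ v >>).
Proof.
pose phi p : M := << u ++ p ++ v >>.
rewrite -![<< _ >>]/(phi _).
have phi_low N p : (wt p < N)%N -> span (fun w => wt w < wt u + wt v + N)%N (phi p).
  by move=> h; apply: span_word; rewrite !wt_cat; move: h; lia.
elim: r s i j k l => [|r IH] s i j k l.
  have := inIm_gen u v (i, j, k, l, 0%N, s.+1); rewrite /ext_rel (ext_rel0S phi).
  move/span_inIm; apply; apply: span_sub; apply: span_scale; apply: phi_low;
    by rewrite /wt /=; lia.
have := inIm_gen u v (i, j, k, l, r.+1, s.+1); rewrite /ext_rel (ext_relSS phi).
rewrite -addrA -opprD; move/span_inIm; apply; apply: span_add.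
  by have := IH s.+1 i j k l; rewrite !addSn !addnS.
apply/span_scale/span_sub; apply: phi_low; rewrite /wt /=; lia.
Qed.

Variable le : rel (gen n).
Hypothesis le_total : total le.

Lemma span_sorted_word w : span (sorted le) << w >>.
Proof.
have [N] := ubnP (wt w); elim: N w => // N IH w0 hw0.
have low a : span (fun w => wt w < N)%N a -> span (sorted le) a by apply: span_trans.
(* The weight bound in [Q] ensures that the correction terms of a swap fall under the induction
   hypothesis. *)
pose Q w := (wt w <= N)%N -> span (sorted le) << w >>.
have swap u v g h : Q (u ++ [:: h; g] ++ v) -> Q (u ++ [:: g; h] ++ v).
  move=> hQ hN; rewrite -[<< _ >>](subrK << u ++ [:: h; g] ++ v >>).
  apply: span_add; last first.
    apply: hQ; apply: leq_trans hN; rewrite !wt_cat /wt /=; lia.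
  apply: low; case: g h hN {hQ} => [[i j] r] [[k l] s] hN.
  apply: span_trans (comm_low u v i j k l r s) => w hw; apply: span_word.
  apply: leq_trans hw _; apply: leq_trans hN; rewrite !wt_cat /wt /=; lia.
(* Swaps of neighbours are promoted to a letter passing a block and then to exchanges of blocks, the
   form used by [catCA_perm_ind]. *)
have move1 g s u v : Q (u ++ g :: s ++ v) -> Q (u ++ s ++ g :: v).
  elim: s u => [|h s IHs] u //= hQ.
  rewrite -cat_rcons; apply: IHs; rewrite cat_rcons.
  exact: swap.
have block s1 s2 u v : Q (u ++ s1 ++ s2 ++ v) -> Q (u ++ s2 ++ s1 ++ v).
  elim: s1 u => [|g s1 IHs] u //= hQ.
  by apply: move1; rewrite -cat_rcons; apply: IHs; rewrite cat_rcons.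
suff : Q w0 by apply.
have pw : perm_eq (sort le w0) w0 by rewrite perm_sort.
apply: (catCA_perm_ind (P := Q)) pw _ => [s1 s2 s3|_].
  exact: (block _ _ [::]).
exact/span_word/sort_sorted.
Qed.

Lemma span_sorted a : span (sorted le) a.
Proof.
elim/malg_ind: a; [exact: span_zero | exact: span_add | exact: span_scale |].
exact: span_sorted_word.
Qed.

Lemma mal_sorted (l : vec F W) w : all (fun p => sorted le p.2) l ->
  ~~ sorted le w -> (mal l)@_w = 0.
Proof.
move=> /allP hl hw; rewrite -coefv_mal /coefv big1_seq // => p /andP[/eqP pw /hl].
by rewrite pw (negPf hw).
Qed.

Lemma Tens_inIm gs a : inIm a -> Tens (map (@redg F n) gs) (deltam (size gs) a) = 0.
Proof. by move=> /(inJm_deltam (size gs)); apply: Tens_inJm; apply: kills_redg. Qed.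

(** The functionals vanish on the relation ideals, so they take the same value on [delta_m b] as on
    [delta_m a], and there [hbar^m] factors out. *)
Lemma Tens_inDG (gs : W) a b : inDG a -> inIm (a - b) ->
  'X^(size gs) %| (mext (pairing F gs : W -> K^o) b : K).
Proof.
move=> /(_ (size gs)) [c hc] hab; rewrite -Tens_pairing.
have := Tens_inIm gs hab => /linear_comp_sub_eq <-.
have := Tens_inJm (kills_redg F gs) hc => /linear_subZ_eq ->.
exact: dvdp_mulr.
Qed.

Hypothesis charF : [pchar F] =i pred0.
Hypotheses (le_trans : transitive le) (le_anti : antisymmetric le).

Lemma mal_lincomb_pbw l w : (mal (lincomb (@pbw F n) l))@_w = 'X^(size w) * coefv l w.
Proof.
rewrite /mal ext_lincomb /coefv /ext raddf_sum [X in _ = _ * X]big_mkcond mulr_sumr.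
apply: eq_bigr => p _ /=; rewrite big_seq1 /= scalerA mcoeffZ mcoeffU.
by case: eqP => [->|]; rewrite ?mulr1 ?mulr0 // mulrC.
Qed.

Lemma pbw_free l : all (fun p => sorted le p.2) l ->
  inI (lincomb (@pbw F n) l) -> forall w, coefv l w = 0.
Proof.
move=> hl /inImP hI w; set a := mal _ in hI.
have dvd N : 'X^(size w + N) %| a@_w.
  apply: (valuation charF le_trans le_anti) => [v hv|gs].
    rewrite mal_lincomb_pbw coefv_mal mal_sorted // mulr0 //.
  by rewrite -Tens_pairing Tens_inIm ?dvdp0.
have : a@_w = 0.
  (* All pairings vanish, so every [N] is allowed; the size of the coefficient, which exceeds its
     degree, already forces it to be zero. *)
  apply/eqP/negPn/negP => a0; have := dvdp_leq a0 (dvd (size a@_w)).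
  by rewrite size_polyXn ltnNge leq_addl.
by move/eqP; rewrite mal_lincomb_pbw mulf_eq0 (negPf (Xexp_neq0 _ _)) => /eqP.
Qed.

Lemma pbw_span (x : vec F W) : DGdual x ->
  exists l : vec F W, all (fun p => sorted le p.2) l /\
                      inI (vsub x (lincomb (@pbw F n) l)).
Proof.
move=> /DGdualP hx; have [l [hl xl]] := span_sorted (mal x).
set a := mal l in xl.
have a_sorted w : ~~ sorted le w -> a@_w = 0 by exact: mal_sorted.
have dvd w : 'X^(size w) %| a@_w.
  rewrite -[size w]addn0; apply: (valuation charF le_trans le_anti) => // gs.
  by rewrite addn0; apply: Tens_inDG xl.
(* Exact division by [hbar^|k|] turns coefficients of words in [t] into coefficients of words in
   [hbar t]. *)
exists [seq (a@_k %/ 'X^(size k), k) | k <- msupp a]; split.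
  rewrite all_map; apply/allP => k /=; rewrite -mcoeff_neq0.
  by apply: contraR => /a_sorted ->.
apply/inImP; rewrite mal_sub (_ : mal (lincomb _ _) = a) //.
rewrite /mal ext_lincomb /ext big_map [RHS]monalgE; apply: eq_bigr => k _ /=.
by rewrite big_seq1 /= scalerA divpK // scale_malgU.
Qed.

End Generation.

(** * The PBW basis of the dual and the equality with the subalgebra *)

Theorem theoremA10 (F : fieldType) (n : nat) (le : rel (gen n)) :
  [pchar F] =i pred0 ->
  reflexive le -> transitive le -> antisymmetric le -> total le ->
  [/\ (* ordered PBW monomials in hbar t lie in Y' *)
      forall w : word n, sorted le w -> DGdual (pbw F w),
      (* they are linearly independent over C[hbar] *)
      forall l : vec F (word n), all (fun p => sorted le p.2) l ->
        inI (lincomb (@pbw F n) l) -> forall w, coefv l w = 0,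
      (* they span Y' *)
      forall x : vec F (word n), DGdual x ->
        exists l : vec F (word n), all (fun p => sorted le p.2) l /\
                                   inI (vsub x (lincomb (@pbw F n) l)) &
      (* Y' equals the subalgebra generated by the hbar t^{(r)}_{ij} *)
      forall x : vec F (word n), DGdual x <->
        exists l : vec F (word n), inI (vsub x (lincomb (@pbw F n) l))].
Proof.
move=> charF _ le_trans le_anti le_total; split.
- by move=> w _; apply/DGdualP/inDG_pbw.
- exact: pbw_free.
- exact: pbw_span.
move=> x; split=> [/(pbw_span le_total charF le_trans le_anti) [l [_ hl]]|[l hl]].
  by exists l.
apply/DGdualP; apply: inDG_inIm (inDG_lincomb l).
by move/inImP: hl; rewrite mal_sub.
Qed.
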